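(* Let $F=F(a_1,\dots,a_k)$ be a free group of rank $k\ge 2$ with the standard word metric $d$ corresponding to the free basis $\{a_1,\dots,a_k\}$. Put $d_0:=1+\frac{2k-3}{4k^2-2k}$. There exists an exponentially $\mathcal{CR}$-generic set $C\subseteq\mathcal{CR}$ with the following property. For any $\phi\in Aut(F)$ the following conditions are equivalent: (1) The automorphism $\phi$ is simple. (2) $\lambda(\phi)=1$. (3) $\lambda(\phi)<1+\frac{2k-3}{2k^2-k}$. (4) The map $\phi:(F,d)\to(F,d)$ is a rough isometry. (5) The map $\phi:(F,d)\to(F,d)$ is a rough similarity. (6) For some $w\in C$ we have $\|\phi(w)\|=\|w\|$. (7) For every $w\in C$ we have $\|\phi(w)\|=\|w\|$. (8) For some $w\in C$ we have $\|\phi(w)\|\le d_0\|w\|$. (9) For every $w\in C$ we have $\|\phi(w)\|\le d_0\|w\|$.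
   Context: Let $A=\{a_1,\dots,a_k\}$. $|w|$ is the freely reduced length of $w\in F$ over $A^{\pm1}$ and $\|w\|$ is its cyclically reduced length, i.e. the length of any cyclically reduced word conjugate to $w$. $\mathcal{CR}$ is the set of all cyclically reduced words in $F$. Exponentially $\mathcal{CR}$-generic: for $C\subseteq\mathcal{CR}$, if $P_n'$ denotes the uniform probability measure on the set of cyclically reduced words of length $n$, then $\lim_{n\to\infty}P_n'(C)=1$ with exponentially fast convergence, i.e. there are $D>0$, $0<\sigma<1$ with $|P_n'(C)-1|\le D\sigma^n$ for all $n\ge1$. An automorphism of $F$ is a relabeling automorphism if it is induced by a permutation of the set $\{a_1,\dots,a_k\}^{\pm1}$. An automorphism is simple if it is the composition of a relabeling automorphism and a conjugation (inner automorphism). A map $f:(X,d)\to(X',d')$ is a rough isometry if there is $D>0$ with $|d'(f(x),f(y))-d(x,y)|\le D$ for all $x,y\in X$; it is a rough similarity if there are $\lambda>0$ and $D>0$ with $|d'(f(x),f(y))-\lambda d(x,y)|\le D$ for all $x,y\in X$. The generic stretching factor $\lambda(\phi)$: $\partial F$ is the set of semi-infinite freely reduced words over $A^{\pm1}$; $\omega_n$ is the initial segment of length $n$ of $\omega\in\partial F$; $\mu_A$ is the Borel probability measure on $\partial F$ giving the set of all $\omega$ beginning with a freely reduced word $v\neq1$ the mass $\frac{1}{2k(2k-1)^{|v|-1}}$. Then $\lambda(\phi)$ is the constant such that $\lim_{n\to\infty}\frac{|\phi(\omega_n)|}{n}=\lambda(\phi)$ for $\mu_A$-a.e. $\omega$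 (this constant exists). *)

(* Defs.v *)
(* MathComp / MathComp-Analysis; real numbers are an arbitrary [R : realType]. *)
From HB Require Import structures.
From mathcomp Require Import all_boot all_order all_algebra perm.
From mathcomp Require Import all_classical all_reals all_analysis.

Set Implicit Arguments.
Unset Strict Implicit.
Unset Printing Implicit Defensive.

Import Order.TTheory GRing.Theory Num.Theory.
Import numFieldNormedType.Exports.

Local Open Scope classical_set_scope.
Local Open Scope ring_scope.

(* [(i, false)] is the basis element [a_i] and [(i, true)] its inverse. *)
Definition letter (k : nat) : finType := ('I_k * bool)%type.

Section Words.
Context {k : nat}.
Implicit Types (x y : letter k) (s t u : seq (letter k)).

Definition linv x : letter k := (x.1, ~~ x.2).

Definition no_cancel : rel (letter k) := fun x y => y != linv x.

Definition reduced s : bool := sorted no_cancel s.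

(* [cycle] also compares the last letter with the first one. *)
Definition cyclically_reduced s : bool := cycle no_cancel s.

Definition push x s : seq (letter k) :=
  if s is y :: s' then if y == linv x then s' else x :: s else [:: x].

Definition reduce s : seq (letter k) := foldr push [::] s.

Lemma linvK : involutive linv.
Proof. by case=> i b; rewrite /linv /= negbK. Qed.

Lemma push_reduced x s : reduced s -> reduced (push x s).
Proof.
case: s => [|y s] //= sy; case: eqVneq => [_|yx]; first exact: path_sorted sy.
by rewrite /= /no_cancel yx.
Qed.

Lemma foldr_push_reduced s t : reduced t -> reduced (foldr push t s).
Proof. by move=> rt; elim: s => //= x s; exact: push_reduced. Qed.

Lemma reduce_reduced s : reduced (reduce s).
Proof. exact: foldr_push_reduced. Qed.

Lemma reduce_id s : reduced s -> reduce s = s.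
Proof.
elim: s => //= x s IHs sx; rewrite IHs; last exact: path_sorted sx.
by case: s sx {IHs} => //= y s /andP[/negPf yx _]; rewrite yx.
Qed.

Lemma pushK x s : reduced s -> push x (push (linv x) s) = s.
Proof.
case: s => [|y s] /=; first by rewrite eqxx.
rewrite linvK; case: eqVneq => [->|_ _] /=; last by rewrite eqxx.
by case: s => //= z s /andP[/negPf zx _]; rewrite zx.
Qed.

Lemma foldr_push_reduce s t :
  reduced t -> foldr push t (reduce s) = foldr push t s.
Proof.
move=> rt; elim: s => //= x s <-.
case: (reduce s) => //= y u; case: eqVneq => [->|//].
by rewrite pushK// foldr_push_reduced.
Qed.

Lemma reduce_cat s t : reduce (s ++ t) = foldr push (reduce t) s.
Proof. by rewrite /reduce foldr_cat. Qed.

Lemma reduce_catl s t : reduce (reduce s ++ t) = reduce (s ++ t).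
Proof. by rewrite !reduce_cat foldr_push_reduce// reduce_reduced. Qed.

Lemma reduce_catr s t : reduce (s ++ reduce t) = reduce (s ++ t).
Proof. by rewrite !reduce_cat reduce_id// reduce_reduced. Qed.

Definition winv s : seq (letter k) := rev (map linv s).

Lemma winvK : involutive winv.
Proof. by move=> s; rewrite /winv map_rev revK mapK//; exact: linvK. Qed.

Lemma reduce_winvr s : reduce (s ++ winv s) = [::].
Proof.
elim: s => //= x s IHs; rewrite /winv /= rev_cons -cats1 catA.
by rewrite -/(winv s) -reduce_catl IHs /= eqxx.
Qed.

Lemma reduce_winvl s : reduce (winv s ++ s) = [::].
Proof. by rewrite -{2}[s]winvK reduce_winvr. Qed.

End Words.

Record free_group (k : nat) := FreeGroup {
  word :> seq (letter k);
  word_reduced : reduced word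
}.

HB.instance Definition _ k := [isSub for @word k].
HB.instance Definition _ k := [Choice of free_group k by <:].

(* The element of the free group represented by a not necessarily reduced word. *)
Definition of_word k (s : seq (letter k)) : free_group k :=
  FreeGroup (reduce_reduced s).

Section FreeGroup.
Context {k : nat}.
Implicit Types u v w : free_group k.

Definition fg_one : free_group k := of_word [::].
Definition fg_mul u v : free_group k := of_word (u ++ v).
Definition fg_inv u : free_group k := of_word (winv u).

Lemma fg_mulA : associative fg_mul.
Proof.
by move=> u v w; apply: val_inj; rewrite /= reduce_catr reduce_catl catA.
Qed.

Lemma fg_mul1 : left_id fg_one fg_mul.
Proof. by case=> s rs; apply: val_inj; rewrite /= reduce_id. Qed.

Lemma fg_1mul : right_id fg_one fg_mul.
Proof. by case=> s rs; apply: val_inj; rewrite /= cats0 reduce_id. Qed.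

Lemma fg_mulV : left_inverse fg_one fg_inv fg_mul.
Proof.
by move=> u; apply: val_inj; rewrite /= reduce_catl reduce_winvl.
Qed.

Lemma fg_Vmul : right_inverse fg_one fg_inv fg_mul.
Proof.
by move=> u; apply: val_inj; rewrite /= reduce_catr reduce_winvr.
Qed.

End FreeGroup.

HB.instance Definition _ k := isGroup.Build (free_group k)
  fg_mulA fg_mul1 fg_1mul fg_mulV fg_Vmul.

Section Lengths.
Context {k : nat}.
Implicit Types u v w : free_group k.

Definition len w : nat := size w.

(* All cyclically reduced conjugates of [w] have the same length, so the choice
   made by [xget] is immaterial. *)
Definition cyclic_len w : nat :=
  len (xget w [set v | cyclically_reduced v /\ exists g, v = (w ^ g)%g]).

Definition word_dist (R : realType) u v : R := (len (u^-1 * v)%g)%:R.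

Definition CR : set (free_group k) := [set w | cyclically_reduced w].

(* Uniform probability of [C] on the cyclically reduced words of length [n]. *)
Definition CR_prob (R : realType) (n : nat) (C : set (free_group k)) : R :=
  #|[pred t : n.-tuple (letter k) |
      cyclically_reduced t && `[< C (of_word t) >]]|%:R
  / #|[pred t : n.-tuple (letter k) | cyclically_reduced t]|%:R.

Definition exp_CR_generic (R : realType) (C : set (free_group k)) : Prop :=
  C `<=` CR /\
  exists D sigma : R, [/\ 0 < D, 0 < sigma < 1 &
    forall n : nat, (1 <= n)%N -> `|CR_prob R n C - 1| <= D * sigma ^+ n].

Definition relabeling (psi : {multiplicative free_group k -> free_group k}) :
    Prop :=
  bijective psi /\
  exists s : {perm letter k},
    forall x : letter k, psi (of_word [:: x]) = of_word [:: s x].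

Definition simple_aut (phi : {multiplicative free_group k -> free_group k}) :
    Prop :=
  exists psi : {multiplicative free_group k -> free_group k},
    relabeling psi /\
    exists g : free_group k, forall w, phi w = (psi w ^ g)%g.

End Lengths.

Definition rough_isometry (R : realType) (X X' : Type)
    (d : X -> X -> R) (d' : X' -> X' -> R) (f : X -> X') : Prop :=
  exists D : R, 0 < D /\ forall x y, `|d' (f x) (f y) - d x y| <= D.

Definition rough_similarity (R : realType) (X X' : Type)
    (d : X -> X -> R) (d' : X' -> X' -> R) (f : X -> X') : Prop :=
  exists lambda D : R, [/\ 0 < lambda, 0 < D &
    forall x y, `|d' (f x) (f y) - lambda * d x y| <= D].

(* The index [hk] only serves to make the type inhabited, as a
   measurable type built from a sigma-algebra has to be pointed. *)
Record boundary (k : nat) (hk : (2 <= k)%N) := Boundary {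
  ray :> nat -> letter k;
  ray_reduced : forall n, no_cancel (ray n) (ray n.+1)
}.

Section Boundary.
Context {k : nat} {hk : (2 <= k)%N}.

HB.instance Definition _ := gen_eqMixin (boundary hk).
HB.instance Definition _ := gen_choiceMixin (boundary hk).

Definition constant_ray : boundary hk.
Proof.
exists (fun=> (Ordinal (ltnW hk), false) : letter k) => n.
by rewrite /no_cancel /linv xpair_eqE andbF.
Defined.

HB.instance Definition _ := isPointed.Build (boundary hk) constant_ray.

Definition initial_segment (omega : boundary hk) (n : nat) : free_group k :=
  of_word (mkseq omega n).

Definition cylinder (v : seq (letter k)) : set (boundary hk) :=
  [set omega : boundary hk | mkseq omega (size v) = v].

(* The topology with basis the cylinders. *)
Definition boundary_open : set (set (boundary hk)) :=
  [set U | forall omega : boundary hk, U omega ->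
     exists n, cylinder (mkseq omega n) `<=` U].

End Boundary.

Definition borel_boundary (k : nat) (hk : (2 <= k)%N) :
    measurableType (sigma_display (@boundary_open k hk)) :=
  g_sigma_algebraType (@boundary_open k hk).

(* This determines [mu], as the cylinders form a generating pi-system. *)
Definition uniform_boundary_measure (R : realType) (k : nat) (hk : (2 <= k)%N)
    (mu : probability (borel_boundary hk) R) : Prop :=
  forall v : free_group k, v != 1%g ->
    mu (cylinder v) =
      ((2 * k%:R * (2 * k%:R - 1) ^+ (len v - 1)%N)^-1)%:E.

(* "The generic stretching factor of [phi] exists and equals [l]". *)
Definition is_stretching_factor (R : realType) (k : nat) (hk : (2 <= k)%N)
    (mu : probability (borel_boundary hk) R)
    (phi : free_group k -> free_group k) (l : R) : Prop :=
  {ae mu, forall omega : boundary hk,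
    ((len (phi (initial_segment omega n)))%:R / n%:R : R) @[n --> \oo] --> l}.

(* Main.v *)
(* View a basis element [a_i] as an edge of the Cayley
   tree; deleting it splits the free group in two, and pulling the splitting back by
   [phi] gives a finite cut [U_i] of the tree. The length of [phi u] is the number of
   pairs [(h, i)] such that the translate [h U_i] separates [1] from [u].

   Up to finitely many elements [U_i] is one of three things: a half-tree; a
   2-colouring, with at least two directions of each colour, of the [2k] directions at
   a vertex; or a cut with at least two leaves, i.e. vertices at which all directions
   but one are coloured and both colours occur. A word is separated by a translate of
   the cut whenever it passes through the corresponding vertex between directions of
   different colours, so [phi u] is at least as long as a weighted number of 2-letter
   subwords of [u], where in the last two cases the weights sum to at least
   [2 (4k - 4)], against [2 (2k - 1)] for a half-tree. If all the [U_i] are half-trees,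
   these must be the half-trees at one vertex, and [phi] is simple. Otherwise the weights
   sum to at least [2k (2k - 1) + 2 (2k - 3)], and as the 2-letter subwords of a generic
   word are equidistributed, generic words are stretched by at least
   [1 + (2k - 3) / (2k^2 - k)]. *)

Require Import Defs.
From HB Require Import structures.
From mathcomp Require Import all_boot all_order all_algebra perm.
From mathcomp Require Import all_classical all_reals all_analysis.
From mathcomp Require Import measurable_realfun zify ring lra.

Set Implicit Arguments.
Unset Strict Implicit.
Unset Printing Implicit Defensive.

Import Order.TTheory GRing.Theory Num.Theory.
Import numFieldNormedType.Exports.
Local Open Scope classical_set_scope.
Local Open Scope ring_scope.

(** * The free group as a tree *)

Section FreeGroupWords.
Context {k : nat}.
Implicit Types (g h p v : free_group k) (x y a : letter k).
Implicit Types s t : seq (letter k).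
Local Open Scope group_scope.

Definition gen x : free_group k := of_word [:: x].

Definition starts x g : bool := if word g is y :: _ then y == x else false.

Lemma word_inj : injective (@word k).
Proof. exact: val_inj. Qed.

Lemma word_of_word s : reduced s -> word (of_word s) = s.
Proof. exact: reduce_id. Qed.

Lemma of_wordK g : of_word (word g) = g.
Proof. by apply: word_inj; rewrite word_of_word //; case: g. Qed.

Lemma of_word_cat s t : of_word (s ++ t) = of_word s * of_word t.
Proof. by apply: word_inj; rewrite /= reduce_catr reduce_catl. Qed.

Lemma of_word_cons x s : of_word (x :: s) = gen x * of_word s.
Proof. by rewrite -cat1s of_word_cat. Qed.

Lemma of_word_rcons s x : of_word (rcons s x) = of_word s * gen x.
Proof. by rewrite -cats1 of_word_cat. Qed.

Lemma of_word_nil : of_word [::] = 1 :> free_group k.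
Proof. by []. Qed.

Lemma no_cancelC x y : no_cancel x (linv y) = no_cancel y (linv x).
Proof. by rewrite /no_cancel !(can_eq linvK) eq_sym. Qed.

Lemma no_cancel_linv x y : no_cancel (linv y) (linv x) = no_cancel x y.
Proof. by rewrite no_cancelC linvK. Qed.

Lemma no_cancel_refl x : no_cancel x x.
Proof. by case: x => i b; rewrite /no_cancel /linv xpair_eqE; case: b; rewrite andbF. Qed.

Lemma winv_reduced s : reduced s -> reduced (winv s).
Proof.
rewrite /reduced /winv rev_sorted sorted_map => rs; rewrite (@eq_sorted _ _ no_cancel) //.
by move=> x y /=; rewrite no_cancel_linv.
Qed.

Lemma word_inv g : word g^-1 = winv (word g).
Proof. by rewrite /= reduce_id //; apply: winv_reduced; case: g. Qed.

Lemma gen_inv x : (gen x)^-1 = gen (linv x).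
Proof. by apply: word_inj; rewrite word_inv. Qed.

Lemma word_mul_gen p y : word (p * gen y) =
  if (word p != [::]) && (last y (word p) == linv y)
  then take (len p).-1 (word p) else rcons (word p) y.
Proof.
case: p => s rs; rewrite /len /=.
case/lastP: s rs => [|s x] rs //=.
rewrite last_rcons size_rcons /= -cats1 take_size_cat //.
have -> /= : s ++ [:: x] != [::] by case: (s).
case: eqVneq => [->|xy].
  rewrite -catA -reduce_catr /= linvK eqxx cats0 reduce_id //.
  by move: rs; rewrite -cats1 /reduced => /cat_sorted2 [].
rewrite -catA /= reduce_id; first by rewrite -[RHS]cats1 -catA.
move: rs; rewrite /reduced; case: (s) => [|z u] /=.
  by rewrite !andbT /no_cancel => _; rewrite -(can_eq linvK) linvK eq_sym.
rewrite rcons_path cat_path /= !andbT => /andP[-> ->] /=.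
by rewrite /no_cancel -(can_eq linvK) linvK eq_sym.
Qed.

(** Right multiplication by a letter only alters the end of a reduced word, so the first letter can
    change only when the word is empty or is the single letter that gets cancelled. *)
Lemma ohead_mul_gen p y :
  ohead (word (p * gen y)) != ohead (word p) -> p = 1 \/ p = gen (linv y).
Proof.
rewrite word_mul_gen; case: ifPn => [/andP[]|].
  case: p => [[|x [|z s]] rs] //= _.
    by move=> /eqP xy _; right; apply: word_inj; rewrite /= xy.
  by rewrite /len /= eqxx.
by case: p => [[|x s] rs] /= _; [left; apply: word_inj | rewrite eqxx].
Qed.

Lemma starts_gen x y : starts x (gen y) = (y == x).
Proof. by []. Qed.

Lemma starts1 x : starts x 1 = false.
Proof. by []. Qed.

Lemma starts_mul_gen a p y :
  starts a (p * gen y) != starts a p ->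
  p = 1 /\ y = a \/ p = gen a /\ y = linv a.
Proof.
move=> H; have /ohead_mul_gen [Ep|Ep] : ohead (word (p * gen y)) != ohead (word p).
- by apply: contraNneq H; rewrite /starts; case: (word (p * _)) (word p) => [|? ?] [|? ?] // [->].
- by left; split=> //; move: H; rewrite Ep mul1g starts_gen starts1; case: (y =P a).
move: H; rewrite Ep -gen_inv mulVg starts1 gen_inv starts_gen.
by case: (linv y =P a) => // <- _; right; rewrite linvK.
Qed.

Lemma word_gen_mul x h : word (gen x * h) = push x (word h).
Proof. by rewrite /= /reduce /= -/(reduce _) reduce_id //; case: h. Qed.

(** The edge from [1] to [gen x] bounds two complementary half-trees; seen from [gen x], the one
    containing [1] is the half-tree of [linv x]. *)
Lemma starts_linv x g : starts x g = ~~ starts (linv x) ((gen x)^-1 * g).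
Proof.
rewrite -[g in LHS](mulVKg (gen x)); move: (_ * g) => h.
rewrite /starts word_gen_mul; case: h => [[|y s] rs] //=.
  by rewrite eqxx.
case: eqVneq => [yx|yx] /=; first last.
  by rewrite eqxx.
case: s rs => [|z s] //= /andP[].
rewrite yx /no_cancel linvK => zx _.
by rewrite (negPf zx).
Qed.

Lemma startsP x g :
  reflect (exists2 h, g = gen x * h & len g = (len h).+1 /\ ~~ starts (linv x) h)
          (starts x g).
Proof.
apply: (iffP idP) => [|[h -> [_ hx]]]; last by rewrite starts_linv mulKg.
case: g => [[|y s] rs]; rewrite /starts //= => /eqP yx; subst y.
have rs' : reduced s by exact: path_sorted rs.
exists (FreeGroup rs'); last first.
  by split=> //; move: rs => /=; case: (s) => //= z u /andP[].
apply: word_inj; rewrite word_gen_mul /=.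
by case: (s) rs => //= z u /andP[/negPf zx _]; rewrite zx.
Qed.

Lemma lenP g : (0 < len g)%N -> exists x, starts x g.
Proof. by case: g => [[|x s] rs] // _; exists x; rewrite /starts /= eqxx. Qed.

Lemma starts_mull x h : ~~ starts (linv x) h -> starts x (gen x * h).
Proof. by move=> hx; rewrite starts_linv mulKg. Qed.

Lemma len_gen_mul x h : ~~ starts (linv x) h -> len (gen x * h) = (len h).+1.
Proof.
by move=> hx; have /startsP[h' /mulgI <- [->]] := starts_mull hx.
Qed.

Lemma size_reduce s : (size (reduce s) <= size s)%N.
Proof.
elim: s => //= x s; case: (reduce s) => //= y u; case: ifP => //= _; lia.
Qed.

Lemma len_mul g h : (len (g * h)%g <= len g + len h)%N.
Proof. by rewrite /len /= (leq_trans (size_reduce _)) // size_cat. Qed.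

Lemma len_inv g : len g^-1 = len g.
Proof. by rewrite /len word_inv size_rev size_map. Qed.

Lemma len1 : len (1 : free_group k) = 0%N.
Proof. by []. Qed.

Lemma len_gen x : len (gen x) = 1%N.
Proof. by []. Qed.

Lemma len_mulr_ge g h : (len g <= len (g * h)%g + len h)%N.
Proof. by have := len_mul (g * h) h^-1; rewrite mulgK len_inv. Qed.

Lemma len_mull_ge g h : (len h <= len (g * h)%g + len g)%N.
Proof. by have := len_mul g^-1 (g * h); rewrite mulKg len_inv addnC. Qed.

(** Multiplying by the letters of [h] one at a time, the partial products stay too long for
    [ohead_mul_gen] to allow a change of first letter. *)
Lemma ohead_mul g h : (len h < len g)%N -> ohead (word (g * h)) = ohead (word g).
Proof.
rewrite -(of_wordK h) {1}/len word_of_word; last by case: h.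
move: (word h) => s; elim: s g => [|y s IHs] g; first by rewrite mulg1.
rewrite of_word_cons mulgA => lg; rewrite IHs.
  by apply/eqP; apply: contraTT lg => /ohead_mul_gen [] ->.
by rewrite /= in lg; have := len_mulr_ge g (gen y); rewrite len_gen addn1 => /(leq_trans lg).
Qed.

Lemma free_group_ind (P : free_group k -> Prop) :
  P 1 -> (forall x h, ~~ starts (linv x) h -> P h -> P (gen x * h)) -> forall g, P g.
Proof.
move=> P1 PS g; move: {2}(len g) (erefl (len g)) => n.
elim: n g => [|n IHn] g lg.
  by have -> : g = 1 by case: g lg => [[|x s] rs] //= _; exact: word_inj.
have [x] := @lenP g ltac:(by rewrite lg).
case/startsP => h gE [lh hx]; rewrite gE; apply: PS => //; apply: IHn.
by apply/eqP; rewrite -eqSS -lh lg.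
Qed.

End FreeGroupWords.

(** * Half-trees and colourings of their ends *)

Section Cones.
Context {k : nat}.
Implicit Types (g h p v : free_group k) (x y z a : letter k).
Implicit Types s t : seq (letter k).
Local Open Scope group_scope.

(** The edges of the path spelled by [s] from [1], where [(h, i)] encodes the edge joining [h] to
    [h * a_i]. An inverse letter runs along its edge backwards, so that edge is based at its far
    end. *)
Fixpoint edges s : seq (free_group k * 'I_k) :=
  if s is x :: s' then
    ((if x.2 then gen x else 1), x.1) :: [seq (gen x * e.1, e.2) | e <- edges s']
  else [::].

Lemma size_edges s : size (edges s) = size s.
Proof. by elim: s => //= x s IHs; rewrite size_map IHs. Qed.

(** The translate by [h] of the half-tree of [a_i] is bounded by the single edge [(h, i)], so a path
    whose ends it separates must traverse that edge. *)
Lemma mem_edges s h i :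
  starts (i, false) (h^-1 * of_word s) != starts (i, false) h^-1 ->
  (h, i) \in edges s.
Proof.
elim: s h => [|x s IHs] h; first by rewrite of_word_nil mulg1 eqxx.
rewrite of_word_cons mulgA /= inE.
have [E H|NE _] := eqVneq (starts (i, false) (h^-1 * gen x)) (starts (i, false) h^-1).
  apply/orP; right; apply/mapP; exists ((gen x)^-1 * h, i); last by rewrite mulVKg.
  by apply: IHs; rewrite invgM invgK E.
apply/orP; left; move/starts_mul_gen: NE => [[hE ->]|[hE ->]].
  by rewrite -(invgK h) hE invg1.
by rewrite -(invgK h) hE gen_inv.
Qed.

(** This bounds lengths from below: distinct translated half-trees separating [1] from [v] use up
    distinct edges of the path to [v]. *)
Lemma size_crossings v (L : seq (free_group k * 'I_k)) : uniq L ->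
  {in L, forall e,
    starts (e.2, false) (e.1^-1 * v) != starts (e.2, false) e.1^-1} ->
  (size L <= len v)%N.
Proof.
move=> uL HL; rewrite /len -size_edges; apply: uniq_leq_size => // -[h i] /HL.
by rewrite -{1}(of_wordK v) => /mem_edges.
Qed.

Lemma starts_inj g x y : starts x g -> starts y g -> x = y.
Proof. by case: g => [[|z s] rs] //; rewrite /starts /= => /eqP <- /eqP. Qed.

Lemma starts_mul_genl x y g : starts y g -> y != linv x -> starts x (gen x * g).
Proof.
move=> yg yx; apply: starts_mull; apply: contraNN yx => xg.
by rewrite (starts_inj yg xg).
Qed.

Lemma starts_of_word_cons x s : reduced (x :: s) -> starts x (of_word (x :: s)).
Proof. by move=> rs; rewrite /starts word_of_word //= eqxx. Qed.

(** A cone is connected, so being constant along its edges is being constant on it. *)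
Lemma cone_constant (T : Type) (P : free_group k -> T) v x :
  (forall g y, starts x g -> starts x (g * gen y) ->
     P (v * (g * gen y)) = P (v * g)) ->
  forall g, starts x g -> P (v * g) = P (v * gen x).
Proof.
move=> HP g; rewrite -(of_wordK g).
case: g => [[|y s] rs] //=; rewrite /starts word_of_word //= => /eqP yx.
subst y; elim/last_ind: s rs => // s z IHs rs.
have rs' : reduced (x :: s).
  by move: rs; rewrite -rcons_cons -cats1 => /cat_sorted2[].
rewrite -IHs // -[x :: rcons s z]rcons_cons of_word_rcons HP //.
  exact: starts_of_word_cons.
by rewrite -of_word_rcons rcons_cons starts_of_word_cons.
Qed.

Section Limits.
Variable U : free_group k -> bool.

(* Only the ends of the half-tree matter: [U] may take both values on it. *)
Definition limit_on v x c : Prop :=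
  exists M, forall g, starts x g -> (M <= len g)%N -> U (v * g) = c.

(** The ends in direction [x] are distributed over the finitely many directions leading onward from
    [v * gen x], so a common bound can be taken. *)
Lemma limit_on_children v x c :
  (forall y, y != linv x -> limit_on (v * gen x) y c) -> limit_on v x c.
Proof.
move=> H.
have /choice[M HM] : forall y, exists M, y != linv x ->
    forall g, starts y g -> (M <= len g)%N -> U (v * gen x * g) = c.
  move=> y; have [_|yx] := eqVneq y (linv x); first by exists 0%N.
  by have [M HM] := H _ yx; exists M.
exists (\max_y M y).+2 => g /startsP[h -> [-> hx]] lh.
have [|y hy] := @lenP _ h; first by lia.
rewrite mulgA (HM y) //; first by apply: contraNneq hx => <-.
by have := @leq_bigmax _ M y; lia.
Qed.

Definition colouring v (chi : letter k -> option bool) : Prop :=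
  forall x c, chi x = Some c -> limit_on v x c.

Definition two_coloured (chi : letter k -> option bool) : Prop :=
  forall c, exists x, chi x = Some c.

Lemma colouring_exists v (S : pred (letter k)) :
  (forall x, S x -> exists c, limit_on v x c) ->
  exists2 chi, colouring v chi & forall x, (chi x != None) = S x.
Proof.
move=> H.
have /choice[chi Hchi] : forall x, exists o, (o != None) = S x /\
    forall c, o = Some c -> limit_on v x c.
  move=> x; case Sx : (S x); last by exists None.
  by have [c Hc] := H _ Sx; exists (Some c); split=> // c' [<-].
by exists chi => [x|x]; have [] := Hchi x.
Qed.

(** The colouring says nothing about [U] in the direction [z], which leads to the rest of the
    cut. *)
Definition leaf v z : Prop := exists chi,
  [/\ colouring v chi, two_coloured chi & forall x, (chi x != None) = (x != z)].

(** Descend into a child cone without a limit as long as there is one; since [U] is constant along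
    edges at depth [d], this stops. At that point all onward directions have limits, and by
    [limit_on_children] they cannot all agree. *)
Lemma leaf_exists d v x :
  (forall g y, starts x g -> (d <= len g)%N -> U (v * (g * gen y)) = U (v * g)) ->
  ~ (exists c, limit_on v x c) ->
  exists u z, starts x u /\ leaf (v * u) z.
Proof.
elim: d v x => [|d IHd] v x HU Hx.
  case: Hx; exists (U (v * gen x)), 0%N => g xg _.
  by apply: (cone_constant (P := U)) => // h y xh _; exact: HU.
have [H|] := pselect (forall y, y != linv x -> exists c, limit_on (v * gen x) y c).
  have [chi Hchi Schi] := @colouring_exists _ (fun y => y != linv x) H.
  exists (gen x), (linv x); split; first by rewrite starts_gen.
  exists chi; split=> // c; apply: contrapT => Hc.
  case: Hx; exists (~~ c); apply: limit_on_children => y yx.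
  apply: Hchi; case E: (chi y) => [b|]; last by move: (Schi y); rewrite E yx.
  by congr Some; case: (b =P c) E => [->|/eqP]; [move=> ?; case: Hc; exists y | case: b c {Hc} => -[]].
move=> /existsNP[y /not_implyP[yx Hy]].
have [|s [z [ys Hs]]] := IHd (v * gen x) y _ Hy.
  move=> g w yg lg; have := HU (gen x * g) w; rewrite !mulgA; apply.
    exact: starts_mul_genl yg yx.
  rewrite len_gen_mul //; apply: contraNN yx => xg.
  by rewrite (starts_inj yg xg).
exists (gen x * s), z; rewrite mulgA; split=> //; exact: starts_mul_genl ys yx.
Qed.

(* If at every vertex some end is not coloured, then following such an end away from
   one leaf leads to a second leaf facing it. *)
Lemma star_or_leaves N :
  (forall p y, (N <= len p)%N -> U (p * gen y) = U p) ->
  (forall M c, exists2 p, (M <= len p)%N & U p = c) ->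
  (exists v chi, [/\ colouring v chi, two_coloured chi & forall x, chi x != None]) \/
  (exists v u z z', [/\ starts z u, leaf v z & leaf (v * u) z']).
Proof.
move=> HN HU.
have far v x : forall g y, starts x g -> (N + len v <= len g)%N ->
    U (v * (g * gen y)) = U (v * g).
  move=> g y _ lg; rewrite mulgA HN //.
  by move: (len_mull_ge v g) lg; move: (len (v * g)) => l; lia.
have [[v Hv]|/forallNP H] := pselect (exists v, forall x, exists c, limit_on v x c).
  have [chi Hchi Schi] := @colouring_exists v predT (fun x _ => Hv x).
  left; exists v, chi; split=> // c; apply: contrapT => Hc.
  (* If the colour [c] were missing, every end would have the colour [~~ c], and [U] could take the
     value [c] only on a bounded set. *)
  have {}Hchi x : exists M, forall g, starts x g -> (M <= len g)%N -> U (v * g) = ~~ c.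
    apply: Hchi; case E: (chi x) => [b|]; last by move: (Schi x); rewrite E.
    by congr Some; case: (b =P c) E => [->|/eqP]; [move=> ?; case: Hc; exists x | case: b c {Hc} => -[]].
  have /choice[M HM] := Hchi.
  have [p lp Up] := HU ((\max_y M y).+1 + len v)%N c.
  have {}lvp : (\max_y M y < len (v^-1 * p)%g)%N.
    by move: (len_mull_ge v^-1 p) lp; rewrite len_inv; move: (len (v^-1 * p)) => l; lia.
  have [|x xg] := @lenP _ (v^-1 * p); first exact: leq_ltn_trans lvp.
  have := HM x _ xg (leq_trans (@leq_bigmax _ M x) (ltnW lvp)).
  by rewrite mulVKg Up; case: (c).
right.
have /existsNP[x0 /(leaf_exists (@far 1 x0))[v [z [_]]]] := H 1.
rewrite mul1g => Hv; have /existsNP[x Hx] := H v.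
have xz : x = z.
  apply: contrapT => /eqP xz; case: Hv => chi [Hchi _ Schi].
  move: (Schi x); rewrite xz; case E: (chi x) => [c|] // _; case: Hx.
  by exists c; exact: Hchi.
have [s [z' [zs Hs]]] := leaf_exists (@far v x) Hx.
by exists v, s, z, z'; split=> //; rewrite -xz.
Qed.

End Limits.
End Cones.

(** * Passages of a reduced word through translates of a cut *)

Section Crossings.
Context {k : nat}.
Implicit Types (g h p v : free_group k) (x y z a b : letter k).
Implicit Types s t : seq (letter k).
Local Open Scope group_scope.

Definition adjacent_pairs s : seq (letter k * letter k) := zip s (behead s).

(** A path reading [ab.1] then [ab.2] sees its past in the direction [linv ab.1] of the middle
    vertex and its future in the direction [ab.2]. *)
Definition separates (chi : letter k -> option bool) (ab : letter k * letter k) :=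
  match chi (linv ab.1), chi ab.2 with
  | Some c, Some c' => c != c'
  | _, _ => false
  end.

Lemma separates_no_cancel chi ab : separates chi ab -> no_cancel ab.1 ab.2.
Proof.
rewrite /separates /no_cancel; case: eqVneq => // ->.
by case: (chi _) => // c; rewrite eqxx.
Qed.

Lemma adjacent_pairsE x0 s : adjacent_pairs s =
  [seq (nth x0 s j.-1, nth x0 s j) | j <- iota 1 (size s).-1].
Proof.
rewrite /adjacent_pairs; case: s => [|x s] //=.
apply: (@eq_from_nth _ (x0, x0)) => [|i].
  by rewrite size_zip size_map size_iota /=; lia.
rewrite size_zip => lti; rewrite nth_zip_cond size_zip lti (nth_map 0%N).
  by rewrite nth_iota //=; rewrite /= in lti; lia.
by rewrite size_iota; rewrite /= in lti; lia.
Qed.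

Lemma count_predI_le (T : Type) (P Q : pred T) (l : seq T) :
  (count P l <= count (predI P Q) l + count (predC Q) l)%N.
Proof. by elim: l => //= x l; case: (P x); case: (Q x) => /=; lia. Qed.

Lemma sum_bool_count (T : Type) (P : pred T) (l : seq T) :
  (\sum_(x <- l) (P x : nat) = count P l)%N.
Proof. by rewrite -sum1_count [RHS]big_mkcond; apply: eq_bigr => x _; case: (P x). Qed.

(* Positions at distance less than [M] from either end of [s] are dropped, as the
   colours of the ends at [v] are only attained far from [v]. *)
Definition positions x0 (chi : letter k -> option bool) M s : seq nat :=
  [seq j <- iota 1 (size s).-1 |
    separates chi (nth x0 s j.-1, nth x0 s j) && ((M <= j) && (M <= size s - j))%N].

Lemma size_positions x0 chi M s :
  (count (separates chi) (adjacent_pairs s) <= size (positions x0 chi M s) + 2 * M)%N.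
Proof.
rewrite (adjacent_pairsE x0) count_map size_filter; set n := size s.
set Q := fun j => ((M <= j) && (M <= n - j))%N.
apply: leq_trans (count_predI_le _ Q _) _; rewrite leq_add2l.
have -> : (2 * M = size (iota 0 M ++ iota (n - M).+1 M))%N.
  by rewrite size_cat !size_iota; lia.
rewrite -size_filter; apply: uniq_leq_size => [|j].
  by rewrite filter_uniq ?iota_uniq.
rewrite mem_filter mem_cat !mem_iota /= /Q; lia.
Qed.

(** These are the translations carrying [v] to the vertices of the path of [s] at the selected
    positions. *)
Definition crossings x0 v chi M s : seq (free_group k) :=
  [seq of_word (take j s) * v^-1 | j <- positions x0 chi M s].

Lemma positions_bound x0 chi M s j :
  j \in positions x0 chi M s -> (0 < j < size s)%N.
Proof. by rewrite mem_filter mem_iota => /andP[_]; lia. Qed.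

Lemma take_reduced s j : reduced s -> reduced (take j s).
Proof. by rewrite /reduced -{1}(cat_take_drop j s) => /cat_sorted2[]. Qed.

Lemma drop_reduced s j : reduced s -> reduced (drop j s).
Proof. by rewrite /reduced -{1}(cat_take_drop j s) => /cat_sorted2[]. Qed.

Lemma of_word_inj s t : reduced s -> reduced t -> of_word s = of_word t -> s = t.
Proof. by move=> rs rt /(congr1 (@word k)); rewrite !word_of_word. Qed.

Lemma crossings_uniq x0 v chi M s : reduced s -> uniq (crossings x0 v chi M s).
Proof.
move=> rs; rewrite map_inj_in_uniq ?filter_uniq ?iota_uniq // => i j.
move=> /positions_bound i_s /positions_bound j_s /mulIg.
move=> /(of_word_inj (take_reduced i rs) (take_reduced j rs)) /(congr1 size).
by rewrite !size_take; case: ifP; case: ifP; lia.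
Qed.

Lemma starts_drop x0 s j : reduced s -> (j < size s)%N ->
  starts (nth x0 s j) (of_word (drop j s)).
Proof.
by move=> rs js; rewrite /starts word_of_word ?drop_reduced // (drop_nth x0) ?eqxx.
Qed.

Lemma starts_take x0 s j : reduced s -> (0 < j < size s)%N ->
  starts (linv (nth x0 s j.-1)) (of_word (take j s))^-1.
Proof.
move=> rs js; rewrite /starts word_inv word_of_word ?take_reduced // /winv.
case: j js => // j js.
have js' : (j < size s)%N by lia.
by rewrite (take_nth x0 js') map_rcons rev_rcons /= eqxx.
Qed.

Definition uniform_colouring U v chi M := forall x (c : bool), chi x = Some c ->
  forall g, starts x g -> (M <= len g)%N -> U (v * g) = c.

Lemma colouring_uniform U v chi : colouring U v chi ->
  exists M, uniform_colouring U v chi M.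
Proof.
move=> Hchi; have /choice[M HM] : forall x, exists M, forall c : bool, chi x = Some c ->
    forall g, starts x g -> (M <= len g)%N -> U (v * g) = c.
  move=> x; case E : (chi x) => [c|]; last by exists 0%N.
  by have [M HM] := Hchi _ _ E; exists M => c' [<-].
exists (\max_x M x) => x c Hc g xg lg; apply: (HM x) => //.
exact: leq_trans (@leq_bigmax _ M x) lg.
Qed.

(** Seen from the vertex [h * v] of the path, [1] and [of_word s] lie in the two directions taken by
    the path, at distance at least [M], so [U] gives them the two different colours. *)
Lemma crossingsP U x0 v chi M s h :
  uniform_colouring U v chi M -> reduced s -> h \in crossings x0 v chi M s ->
  U (h^-1 * of_word s) != U h^-1.
Proof.
move=> HU rs /mapP[j jP ->]; have js := positions_bound jP.
move: jP; rewrite mem_filter /separates /= => /andP[/and3P[+ Mj Mn] _].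
case E1: (chi _) => [c|] //; case E2: (chi _) => [c'|] // cc'.
have sE : of_word s = of_word (take j s) * of_word (drop j s).
  by rewrite -of_word_cat cat_take_drop.
rewrite invgM invgK [in of_word s]sE -mulgA mulKg.
have jl : (M <= len (of_word (take j s))^-1)%N.
  by rewrite len_inv /len word_of_word ?take_reduced // size_takel //; lia.
have jr : (M <= len (of_word (drop j s)))%N.
  by rewrite /len word_of_word ?drop_reduced // size_drop.
rewrite (HU _ _ E1 _ _ jl) ?starts_take // (HU _ _ E2 _ _ jr) ?starts_drop //.
  by rewrite eq_sym.
by lia.
Qed.

Lemma of_word_take s i j : (i <= j)%N ->
  of_word (take j s) = of_word (take i s) * of_word (drop i (take j s)).
Proof. by move=> ij; rewrite -of_word_cat -{1}(take_takel _ ij) cat_take_drop. Qed.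

(** A common translate would put both [h * v] and [h * v * u] on the path of [s]. As [u] starts with
    [z], the path would then use the direction [z] at [h * v], which has no colour. The three cases
    are the possible orders of the two vertices on the path. *)
Lemma crossings_disjoint x0 v z u chi chi' M s :
  reduced s -> starts z u ->
  chi z = None ->
  {in crossings x0 v chi M s, forall h,
     h \notin crossings x0 (v * u) chi' M s}.
Proof.
move=> rs zu chiz h /mapP[i iP ->]; apply/negP => /mapP[j jP].
have i_s := positions_bound iP; have j_s := positions_bound jP.
rewrite invgM mulgA => /mulIg /(congr1 (fun g => g * u)); rewrite mulgVK => E.
have {E} uE : u = (of_word (take i s))^-1 * of_word (take j s) by rewrite -E mulKg.
move: iP; rewrite mem_filter /separates /= => /andP[/andP[+ _] _].
case E1: (chi (linv _)) => [c|] //; case E2: (chi _) => [c'|] // _.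
have [ij|ji|ij] := ltngtP i j.
- have zE : starts (nth x0 s i) u.
    rewrite uE (of_word_take _ (ltnW ij)) mulKg -{1}(nth_take x0 ij); apply: starts_drop.
      exact: take_reduced.
    by rewrite size_takel //; lia.
  by move: E2; rewrite -(starts_inj zu zE) chiz.
- have zE : starts (linv (nth x0 s i.-1)) u.
    rewrite uE (of_word_take _ (ltnW ji)) invgM mulgVK.
    have si : size (drop j (take i s)) = (i - j)%N by rewrite size_drop size_takel //; lia.
    have : starts (linv (nth x0 (drop j (take i s)) (i - j).-1)) (of_word (drop j (take i s)))^-1.
      rewrite /starts word_inv word_of_word ?drop_reduced ?take_reduced // /winv.
      rewrite -map_rev -si nth_last.
      case/lastP: (drop j (take i s)) si => [|t y _] /=; first by lia.
      by rewrite rev_rcons last_rcons /= eqxx.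
    rewrite nth_drop nth_take; last by lia.
    by have -> : (j + (i - j).-1 = i.-1)%N by lia.
  by move: E1; rewrite -(starts_inj zu zE) chiz.
by move: zu; rewrite uE ij mulVg.
Qed.

Definition ncol (chi : letter k -> option bool) c : nat := \sum_x (chi x == Some c).

Lemma sum_separates chi :
  (\sum_ab (separates chi ab : nat) = 2 * (ncol chi true * ncol chi false))%N.
Proof.
rewrite -(pair_big xpredT xpredT (fun a b => (separates chi (a, b) : nat))) /=.
rewrite (reindex_inj (inv_inj linvK)) /=.
rewrite (eq_bigr (fun a => (chi a == Some true) * ncol chi false +
                         (chi a == Some false) * ncol chi true)%N); last first.
  move=> a _; rewrite /ncol !big_distrr -big_split /=; apply: eq_bigr => b _.
  by rewrite /separates /= linvK; case: (chi a) (chi b) => [[]|] [[]|].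
by rewrite big_split /= -!big_distrl /= -/(ncol _ _) -/(ncol _ _); lia.
Qed.

Lemma ncolD chi : (ncol chi true + ncol chi false = \sum_x (chi x != None : nat))%N.
Proof.
by rewrite -big_split /=; apply: eq_bigr => x _; case: (chi x) => [[]|].
Qed.

Lemma ncol_gt0 chi c : two_coloured chi -> (0 < ncol chi c)%N.
Proof.
by move=> /(_ c)[x xc]; rewrite /ncol (bigD1 x) //= xc eqxx.
Qed.

Lemma card_letter : #|letter k| = (2 * k)%N.
Proof. by rewrite card_prod card_ord card_bool mulnC. Qed.

Definition cone_like (U : free_group k -> bool) :=
  exists v x M, forall p, (M <= len p)%N -> U p = starts x (v^-1 * p).

(** A star with a colour used only once is, far out, the half-tree in that direction or its
    complement; the latter is a half-tree too, by [starts_linv]. *)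
Lemma ncol1_cone_like U v chi c : colouring U v chi -> (forall x, chi x != None) ->
  ncol chi c = 1%N -> cone_like U.
Proof.
move=> /colouring_uniform[M HM] chiN Hc.
have /card1P[x xP] : #|[pred x | chi x == Some c]| == 1%N.
  by rewrite -Hc -sum1_card /ncol big_mkcond /=; apply/eqP/eq_bigr => y _; rewrite inE; case: eqP.
have xc : chi x = Some c by apply/eqP; have := xP x; rewrite !inE eqxx.
have HU p : (M + len v < len p)%N -> U p = starts x (v^-1 * p) (+) ~~ c.
  move=> lp; have lvp : (M < len (v^-1 * p)%g)%N.
    by move: (len_mull_ge v^-1 p) lp; rewrite len_inv; move: (len (v^-1 * p)) => l; lia.
  rewrite -{1}(mulVKg v p).
  case xp : (starts x _); first by rewrite (HM _ _ xc) ?(ltnW lvp) //; case: (c).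
  have [|y yp] := @lenP _ (v^-1 * p); first exact: leq_ltn_trans lvp.
  have yc : chi y = Some (~~ c).
    have yx : y != x by apply: contraFneq xp => <-.
    case E: (chi y) (chiN y) => [b|] // _; congr Some.
    by have := xP y; rewrite !inE E (negPf yx); case: (b) (c) => [] [].
  by rewrite (HM _ _ yc) ?(ltnW lvp) //; case: (c).
case: c {Hc xP xc} HU => HU; first by exists v, x, (M + len v).+1 => p /HU; rewrite addbF.
exists (v * gen x), (linv x), (M + len v).+1 => p /HU ->.
by rewrite invgM -mulgA starts_linv addbT negbK.
Qed.

(* The numbers of colours satisfy [P + Q = 2k] at a star and [P + Q = 2k - 1] at a
   leaf, and separated pairs of letters number [2 P Q]. *)
Lemma weighted_crossings U N (k2 : (2 <= k)%N) :
  (forall p y, (N <= len p)%N -> U (p * gen y) = U p) ->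
  (forall M c, exists2 p, (M <= len p)%N & U p = c) ->
  exists (m : letter k * letter k -> nat) M,
  [/\ forall ab, (0 < m ab)%N -> no_cancel ab.1 ab.2,
      forall s, reduced s -> exists L : seq (free_group k),
        [/\ uniq L, {in L, forall h, U (h^-1 * of_word s) != U h^-1} &
            (\sum_(ab <- adjacent_pairs s) m ab <= size L + M)%N],
      (2 * (2 * k - 1) <= \sum_ab m ab)%N &
      cone_like U \/ (2 * (4 * k - 4) <= \sum_ab m ab)%N].
Proof.
move=> HN HU; pose x0 : letter k := (Ordinal (ltnW k2), false).
have [[v [chi [Hchi Tchi chiN]]]|[v [u [z [z' [zu]]]]]] := star_or_leaves HN HU.
  have [M HM] := colouring_uniform Hchi.
  exists (separates chi), (2 * M)%N; split.
  - by move=> ab; rewrite lt0b => /separates_no_cancel.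
  - move=> s rs; exists (crossings x0 v chi M s); split.
    + exact: crossings_uniq.
    + by move=> h hL; apply: crossingsP HM rs hL.
    + rewrite size_map sum_bool_count; exact: size_positions.
  (* Both numbers of colours are positive, so [P Q >= P + Q - 1 = 2k - 1]. *)
  - rewrite sum_separates; have := ncolD chi.
    rewrite (eq_bigr (fun=> 1%N)) => [|x _]; last by rewrite chiN.
    rewrite sum1_card card_letter; have := ncol_gt0 true Tchi; have := ncol_gt0 false Tchi.
    by nia.
  - have [P1|P1] := eqVneq (ncol chi true) 1%N; first by left; exact: ncol1_cone_like Hchi chiN P1.
    have [Q1|Q1] := eqVneq (ncol chi false) 1%N; first by left; exact: ncol1_cone_like Hchi chiN Q1.
    (* Now both numbers are at least 2, so [P Q >= 2 (P + Q - 2) = 4k - 4]. *)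
    right; rewrite sum_separates; have := ncolD chi.
    rewrite (eq_bigr (fun=> 1%N)) => [|x _]; last by rewrite chiN.
    rewrite sum1_card card_letter; have := ncol_gt0 true Tchi; have := ncol_gt0 false Tchi.
    by nia.
move=> [chi [Hchi Tchi chiN]] [chi' [Hchi' Tchi' chiN']].
have [M1 HM1] := colouring_uniform Hchi; have [M2 HM2] := colouring_uniform Hchi'.
pose M := maxn M1 M2.
have {}HM1 : uniform_colouring U v chi M.
  by move=> x c xc g xg lg; apply: (HM1 _ _ xc) => //; rewrite (leq_trans _ lg) ?leq_maxl.
have {}HM2 : uniform_colouring U (v * u) chi' M.
  by move=> x c xc g xg lg; apply: (HM2 _ _ xc) => //; rewrite (leq_trans _ lg) ?leq_maxr.
(* At a leaf [P Q >= P + Q - 1 = 2k - 2]; it takes both leaves to reach [2 (4k - 4)]. *)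
have bound chi0 z0 : two_coloured chi0 -> (forall x, (chi0 x != None) = (x != z0)) ->
    (4 * k - 4 <= 2 * (ncol chi0 true * ncol chi0 false))%N.
  move=> T0 N0; have := ncolD chi0.
  have -> : \sum_x (chi0 x != None : nat) = (2 * k - 1)%N.
    rewrite (eq_bigr (fun x => (x != z0 : nat))) => [|x _]; last by rewrite N0.
    rewrite -card_letter (cardD1 z0) inE add1n subn1 /= -sum1_card [RHS]big_mkcond /=.
    by apply: eq_bigr => x _; rewrite !inE andbT; case: eqP.
  by have := ncol_gt0 true T0; have := ncol_gt0 false T0; nia.
exists (fun ab => separates chi ab + separates chi' ab)%N, (4 * M)%N.
have tot : (2 * (4 * k - 4) <= \sum_ab (separates chi ab + separates chi' ab))%N.
  rewrite big_split /= !sum_separates.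
  by have := bound _ _ Tchi chiN; have := bound _ _ Tchi' chiN'; lia.
split; last by right.
- move=> ab; rewrite addn_gt0 !lt0b => /orP[] /separates_no_cancel //.
- move=> s rs; exists (crossings x0 v chi M s ++ crossings x0 (v * u) chi' M s); split.
  + rewrite cat_uniq !crossings_uniq // andbT /=; apply/hasPn => h hL.
    have chiz : chi z = None by move: (chiN z); rewrite eqxx; case: (chi z).
    apply/negP => hL'.
    by move: (@crossings_disjoint x0 v z u chi chi' M s rs zu chiz h hL'); rewrite hL.
  + by move=> h; rewrite mem_cat => /orP[]; [apply: crossingsP HM1 rs|apply: crossingsP HM2 rs].
  + rewrite size_cat !size_map big_split /= !sum_bool_count.
    apply: leq_trans (leq_add (size_positions x0 chi M s) (size_positions x0 chi' M s)) _.
    by rewrite addnACA leq_add2l; lia.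
by apply: leq_trans tot; lia.
Qed.

End Crossings.

(** * Cuts that are all half-trees *)

Section MorphFacts.
Local Open Scope group_scope.
Variables (G H : groupType) (f : G -> H).
Hypothesis fM : {morph f : x y / x * y}.

Lemma morph_1 : f 1 = 1.
Proof. by apply: (mulgI (f 1)); rewrite -fM !mulg1. Qed.

Lemma morph_V : {morph f : x / x^-1}.
Proof. by move=> x; apply: (mulgI (f x)); rewrite -fM !mulgV morph_1. Qed.

Lemma morph_X n : {morph f : x / x ^+ n}.
Proof. by move=> x; elim: n => [|n IHn]; rewrite ?morph_1 // !expgS fM IHn. Qed.

End MorphFacts.

Section ConesAreDisjoint.
Context {k : nat}.
Implicit Types (g h p v u : free_group k) (x y z a b : letter k).
Local Open Scope group_scope.

Lemma len_expg x n : len (gen x ^+ n) = n.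
Proof.
have -> : gen x ^+ n = of_word (nseq n x).
  by elim: n => //= n IHn; rewrite expgS of_word_cons IHn.
rewrite /len word_of_word ?size_nseq //.
by elim: n => //= n; case: n => //= n ->; rewrite no_cancel_refl.
Qed.

Lemma starts_expg x n : starts x (gen x ^+ n.+1).
Proof.
have -> : gen x ^+ n.+1 = of_word (nseq n.+1 x).
  by elim: n.+1 => //= m IHm; rewrite expgS of_word_cons IHm.
apply: starts_of_word_cons; rewrite -[_ :: _]/(nseq n.+1 x).
by elim: n => //= n ->; rewrite no_cancel_refl.
Qed.

Lemma starts_mul_expg x z g n : starts x g -> z != linv x -> starts x (g * gen z ^+ n).
Proof.
move=> xg zx; elim: n => [|n IHn]; first by rewrite mulg1.
rewrite expgSr mulgA; apply: contraT => H.
have /starts_mul_gen[[E _]|[_ E]] : starts x (g * gen z ^+ n * gen z) != starts x (g * gen z ^+ n).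
- by rewrite IHn (negPf H).
- by move: IHn; rewrite E.
by rewrite E eqxx in zx.
Qed.

Hypothesis k2 : (2 <= k)%N.

Lemma letter_avoid x y : exists z, (z != x) && (z != y).
Proof.
apply/existsP; apply: contraT => /existsPn H.
have : (#|letter k| <= #|[set x; y]%SET|)%N.
  by apply/subset_leq_card/fintype.subsetP => z _; have := H z; rewrite !inE negb_and !negbK.
rewrite card_letter cards2; case: (x != y); lia.
Qed.

(** From a common point, go on by powers of a letter that backtracks out of neither cone. *)
Lemma cones_meet_far x y u v p M : starts x (u * p) -> starts y (v * p) ->
  exists q, [/\ (M <= len q)%N, starts x (u * q) & starts y (v * q)].
Proof.
move=> xp yp; have [z /andP[zx zy]] := letter_avoid (linv x) (linv y).
exists (p * gen z ^+ (M + len p)); rewrite !mulgA !starts_mul_expg //; split=> //.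
move: (len_mull_ge p (gen z ^+ (M + len p))); rewrite len_expg.
by move: (len (p * _)) => l; lia.
Qed.

(** If two half-trees differ at a point, one of them meets the complement of the other, which is
    also a half-tree; by [cones_meet_far] they then differ arbitrarily far out. So agreement far out
    is equality, and the bounding edge with its orientation determines [e] and [a]. *)
Lemma cone_eq a b e M :
  (forall g, (M <= len g)%N -> starts a (e * g) = starts b g) -> e = 1 /\ a = b.
Proof.
move=> He; have {}He g : starts a (e * g) = starts b g.
  case ag : (starts a _); case bg: (starts b g) => //.
    have bg' : starts (linv b) ((gen b)^-1 * g).
      by move: bg; rewrite starts_linv => /negbT/negbNE.
    have [q [qM aq]] := cones_meet_far M ag bg'.
    by move: aq; rewrite He // starts_linv => /negPf ->.
  have ag' : starts (linv a) ((gen a)^-1 * e * g).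
    by move: ag; rewrite starts_linv mulgA => /negbT/negbNE.
  have [q [qM]] := @cones_meet_far b (linv a) 1 _ g M ltac:(by rewrite mul1g) ag'.
  by rewrite mul1g -He // starts_linv mulgA => /negPf ->.
have e0 : starts a e = false by rewrite -(mulg1 e) He.
(* The edge from [1] to [gen b] bounds the right-hand half-tree, so its translate by [e] must be the
   edge bounding that of [a]. *)
have : starts a (e * gen b) != starts a e by rewrite e0 He starts_gen eqxx.
case/starts_mul_gen => [[-> ->]//|[eE _]].
by move: e0; rewrite eE starts_gen eqxx.
Qed.

(* [2k] almost disjoint cones covering almost all of the group: some vertex [v0] lies
   in none of them, and then each of the [2k] directions at [v0] contains exactly one
   of them. *)
Lemma cones_common_vertex (T : free_group k -> letter k -> bool)
    (v : letter k -> free_group k) (x : letter k -> letter k) M :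
  (forall p, (M <= len p)%N -> exists y, forall z, T p z = (z == y)) ->
  (forall p y, (M <= len p)%N -> T p y = starts (x y) ((v y)^-1 * p)) ->
  exists v0 w, bijective w /\
    forall p y, (M <= len p)%N -> T p y = starts (w y) (v0^-1 * p).
Proof.
move=> T1 Tv.
have disj y z p : starts (x y) ((v y)^-1 * p) -> starts (x z) ((v z)^-1 * p) -> y = z.
  move=> yp zp; have [q [qM]] := cones_meet_far M yp zp.
  rewrite -!Tv //; have [w Hw] := T1 _ qM.
  by rewrite !Hw => /eqP -> /eqP ->.
have [v0 Hv0] : exists v0, forall y, ~~ starts (x y) ((v y)^-1 * v0).
  pose y1 : letter k := (Ordinal (ltnW k2), false).
  have [H|] := pselect (forall y, ~~ starts (x y) ((v y)^-1 * v y1)); first by exists (v y1).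
  move=> /existsNP[y2 /negP/negbNE H2].
  have y12 : y1 != y2 by apply: contraTneq H2 => <-; rewrite mulVg.
  (* The edge bounding the cone of [y1] would also bound the cone of [y2]. The two cones would be
     complementary, leaving no room for the cone of a third letter [y3]. *)
  have H1 : starts (x y1) ((v y1)^-1 * (v y1 * gen (x y1))) by rewrite mulKg starts_gen.
  have H2' : ~~ starts (x y2) ((v y2)^-1 * (v y1 * gen (x y1))).
    by apply: contraNN y12 => H2'; rewrite (disj _ _ _ H1 H2').
  have : starts (x y2) ((v y2)^-1 * v y1 * gen (x y1)) != starts (x y2) ((v y2)^-1 * v y1).
    by rewrite H2 -mulgA (negPf H2').
  case/starts_mul_gen => [[E _]|[E xE]]; first by move: H2; rewrite E.
  have vE : v y1 = v y2 * gen (x y2) by rewrite -E mulVKg.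
  have [y3 /andP[y31 y32]] := letter_avoid y1 y2.
  have H3 : starts (x y3) ((v y3)^-1 * (v y3 * gen (x y3))) by rewrite mulKg starts_gen.
  set p := v y3 * _ in H3.
  have := starts_linv (x y2) ((v y2)^-1 * p); rewrite -xE (mulgA _^-1 _^-1) -invgM -vE.
  case H : (starts (x y2) _); first by rewrite (disj _ _ _ H3 H) eqxx in y32.
  by move=> /esym/negbFE {}H; rewrite (disj _ _ _ H3 H) eqxx in y31.
pose q y := v y * gen (x y).
have /choice[w Hw] : forall y, exists w, starts w (v0^-1 * q y).
  move=> y; apply: lenP; rewrite lt0n; apply/negP => /eqP l0.
  have E : q y = v0 by apply: (mulgI v0^-1); rewrite mulVg; apply: word_inj; exact: size0nil.
  by move: (Hv0 y); rewrite -E /q mulKg starts_gen eqxx.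
(* The cone of [y] is connected and avoids [v0], hence lies in one direction at [v0]: an edge along
   which the direction changes has [v0] as an endpoint. *)
have wP y p : starts (x y) ((v y)^-1 * p) -> starts (w y) (v0^-1 * p).
  move=> yp; rewrite -(mulVKg (v y) p).
  rewrite (cone_constant (P := fun p => starts (w y) (v0^-1 * p)) _ yp) //.
  move=> g z yg ygz; apply/eqP; rewrite !mulgA; apply: contraT.
  case/starts_mul_gen => [[E _]|[E zE]].
    have := Hv0 y; suff -> : v0 = v y * g by rewrite mulKg yg.
    by apply: (mulgI v0^-1); rewrite mulVg mulgA E.
  have := Hv0 y; suff -> : v0 = v y * (g * gen z) by rewrite mulKg ygz.
  by apply: (mulgI v0^-1); rewrite mulVg !mulgA E zE -gen_inv mulgV.
have Tex p : (M <= len p)%N -> exists2 y, T p y & starts (x y) ((v y)^-1 * p).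
  by move=> lp; have [y Hy] := T1 _ lp; exists y; rewrite -?Tv // Hy.
(* Far points in any direction [z] at [v0] belong to some cone, so [w] is onto, hence bijective by
   finiteness. *)
have /choice[sigma sigmaK] : forall z, exists y, w y = z.
  move=> z; pose p := v0 * gen z ^+ (M + len v0).+1.
  have lp : (M <= len p)%N.
    move: (len_mull_ge v0 (gen z ^+ (M + len v0).+1)); rewrite len_expg -/p.
    by move: (len p) => l; lia.
  have [y _ /wP] := Tex _ lp; rewrite mulKg => yz.
  by exists y; exact: starts_inj yz (starts_expg _ _).
have sigma_bij := injF_bij (can_inj sigmaK).
have wK : cancel w sigma by apply/(bij_can_sym sigma_bij).
exists v0, w; split; first by exists sigma.
move=> p y lp; have [y' Ty' /wP wp] := Tex _ lp.
apply/idP/idP => [|yp]; first by rewrite Tv // => /wP.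
by rewrite -(wK y) (starts_inj yp wp) wK.
Qed.

End ConesAreDisjoint.

(** * Half-trees pulled back by an automorphism *)

Section Automorphisms.
Context {k : nat}.
Implicit Types (g h p v u : free_group k) (x y z a b : letter k).
Local Open Scope group_scope.

Lemma morph_lipschitz (f : free_group k -> free_group k) : {morph f : g h / g * h} ->
  exists L, forall g, (len (f g) <= L * len g)%N.
Proof.
move=> fM; exists (\max_x len (f (gen x)))%N.
apply: free_group_ind => [|x h hx IHh]; first by rewrite morph_1 // len1.
rewrite fM len_gen_mul // mulnS (leq_trans (len_mul _ _)) // leq_add //.
exact: (@leq_bigmax _ (fun y => len (f (gen y)))).
Qed.

Variables (f psi : free_group k -> free_group k).
Hypotheses (fM : {morph f : g h / g * h}) (fK : cancel f psi) (psiK : cancel psi f).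

Lemma psiM : {morph psi : g h / g * h}.
Proof. by move=> g h; apply: (can_inj fK); rewrite fM !psiK. Qed.

Lemma morph_proper B : exists N, forall p, (N <= len p)%N -> (B < len (f p))%N.
Proof.
have [L HL] := morph_lipschitz psiM; exists (L * B).+1 => p lp.
rewrite ltnNge; apply/negP => fB; have := HL (f p); rewrite fK.
by have := leq_mul (leqnn L) fB; lia.
Qed.

(** The pulled-back half-tree is a finite cut: [f (p * gen y)] differs from [f p] by a factor of
    bounded length, which cannot reach the first letter once [f p] is long. *)
Lemma starts_far : exists N, forall p y z, (N <= len p)%N ->
  starts z (f (p * gen y)) = starts z (f p).
Proof.
have [N HN] := morph_proper (\max_y len (f (gen y))); exists N => p y z /HN lp.
suff : ohead (word (f p * f (gen y))) = ohead (word (f p)).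
  rewrite fM /starts.
  by case: (word (f p * _)) (word (f p)) => [|? ?] [|? ?] // [->].
apply: ohead_mul; apply: leq_ltn_trans lp.
exact: (@leq_bigmax _ (fun y => len (f (gen y)))).
Qed.

Lemma starts_both z M c : exists2 p, (M <= len p)%N & starts z (f p) = c.
Proof.
have [L HL] := morph_lipschitz fM.
have lp x : (M <= len (psi (gen x ^+ (L * M).+1)))%N.
  have := HL (psi (gen x ^+ (L * M).+1)); rewrite psiK len_expg //.
  by move: (len _) => l; nia.
exists (psi (gen (if c then z else linv z) ^+ (L * M).+1)) => //; rewrite psiK.
case: c; first exact: starts_expg.
apply: contraTF (starts_expg (linv z) (L * M)) => /starts_inj H.
apply/negP => /H; case: z {H} => i b []; by case: b.
Qed.

Definition adjacent_weight (m : letter k * letter k -> nat) (s : seq (letter k)) : nat :=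
  \sum_(ab <- adjacent_pairs s) m ab.

(** The translate by [h] of the cut of index [i] separates [1] from [of_word s] exactly when the
    translate by [f h] of the half-tree of [a_i] separates [1] from [f (of_word s)]. Injectivity of
    [f] keeps these translates distinct, so their number is at most the length of the image. *)
Lemma weighted_length (k2 : (2 <= k)%N) : exists (m : letter k * letter k -> nat) E,
  [/\ forall ab, (0 < m ab)%N -> no_cancel ab.1 ab.2,
      forall s, reduced s -> (adjacent_weight m s <= len (f (of_word s)) + E)%N &
      (forall i, cone_like (fun p => starts (i, false) (f p))) \/
      (2 * k * (2 * k - 1) + 2 * (2 * k - 3) <= \sum_ab m ab)%N].
Proof.
have [N HN] := starts_far.
have H i := weighted_crossings k2 (fun p y lp => HN p y (i, false) lp) (starts_both (i, false)).
have /choice[m /choice[M HmM]] := H.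
exists (fun ab => \sum_i m i ab)%N, (\sum_i M i)%N; split.
- move=> ab; rewrite lt0n sum_nat_eq0 negb_forall => /existsP[i].
  by rewrite -lt0n; have [+ _ _ _] := HmM i; apply.
- move=> s rs.
  have /choice[L HL] : forall i, exists L : seq (free_group k),
      [/\ uniq L, {in L, forall h, starts (i, false) (f (h^-1 * of_word s)) !=
                                   starts (i, false) (f h^-1)} &
          (\sum_(ab <- adjacent_pairs s) m i ab <= size L + M i)%N].
    by move=> i; have [_ + _ _] := HmM i; apply.
  have lE := @size_crossings _ (f (of_word s)) [seq (f h, i) | i <- enum 'I_k, h <- L i].
  rewrite /adjacent_weight exchange_big /=.
  apply: leq_trans (_ : \sum_i (size (L i) + M i) <= _)%N.
    by apply: leq_sum => i _; have [_ _] := HL i.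
  rewrite big_split leq_add2r /=; apply: leq_trans (lE _ _).
  + by rewrite size_allpairs_dep sumnE big_map big_enum.
  + apply: allpairs_uniq_dep; rewrite ?enum_uniq //.
      by move=> i _; have [] := HL i.
    move=> [i h] [j h'] _ _ /= [/(can_inj fK) -> ->] //.
  + move=> e /allpairsPdep[i [h [_ hL ->]]] /=.
    have [_ + _] := HL i; move=> /(_ _ hL).
    by rewrite fM !(morph_V fM).
- have [|/existsNP[j Hj]] := pselect (forall i, cone_like (fun p => starts (i, false) (f p))).
    by left.
  right; rewrite exchange_big (bigD1 j) //=.
  have [_ _ _ [//|mj]] := HmM j.
  (* The total is at least [(k - 1) * 2 (2k - 1) + 2 (4k - 4)], which equals
     [2k (2k - 1) + 2 (2k - 3)]. *)
  have : (\sum_(i < k | i != j) (2 * (2 * k - 1)) <= \sum_(i < k | i != j) \sum_ab m i ab)%N.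
    by apply: leq_sum => i _; have [_ _] := HmM i.
  rewrite sum_nat_const (_ : #|_| = k - 1)%N; last first.
    have := cardC1 j; rewrite card_ord subn1 => <-; exact: eq_card.
  by move: mj; move: (\sum_ab m j ab)%N (\sum_(i < k | i != j) _)%N => A B; nia.
Qed.

(** The half-tree of an inverse letter is a translate of the complement of that of the letter, and
    both operations preserve half-trees. *)
Lemma cone_like_letter : (forall i, cone_like (fun p => starts (i, false) (f p))) ->
  forall y, cone_like (fun p => starts y (f p)).
Proof.
move=> H [i []]; last exact: H.
have [v [x [M HM]]] := H i; pose a : letter k := (i, false); pose c := psi (gen a).
exists (c^-1 * (v * gen x)), (linv x), (M + len c)%N => p lp.
have -> : starts (i, true) (f p) = ~~ starts a (f (c * p)).
  by rewrite fM psiK starts_linv gen_inv.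
rewrite HM.
  by rewrite starts_linv negbK !invgM invgK !mulgA.
by move: (len_mull_ge c p) lp; move: (len (c * p)) => l; lia.
Qed.

(* The half-tree of a letter [y] and that of [y^-1] are exchanged by [y] up to
   complement; transporting this to [v0] determines [psi] on generators. *)
Lemma cone_like_relabel (k2 : (2 <= k)%N) : (forall i, cone_like (fun p => starts (i, false) (f p))) ->
  exists v0 w, bijective w /\ forall y, psi (gen y) = v0 * gen (w y) * v0^-1.
Proof.
move=> /cone_like_letter/choice[v /choice[x /choice[M HM]]].
have [N HN] := morph_proper 0.
have T1 p : (N <= len p)%N -> exists y, forall z, starts z (f p) = (z == y).
  move=> /HN /lenP[y yp]; exists y => z; apply/idP/eqP => [zp|-> //].
  exact: starts_inj zp yp.
pose M' := maxn N (\max_y M y).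
have [v0 [w [wbij Hw]]] := @cones_common_vertex _ k2 (fun p y => starts y (f p)) v x M'
  (fun p lp => T1 p (leq_trans (leq_maxl _ _) lp))
  (fun p y lp => HM y p (leq_trans (leq_trans (@leq_bigmax _ M y) (leq_maxr _ _)) lp)).
exists v0, w; split=> // y; pose c := psi (gen y); pose b := w (linv y).
suff [E wE] : v0^-1 * c * v0 * gen b = 1 /\ w y = linv b.
  rewrite wE -gen_inv; apply: (mulIg (v0 * gen b)).
  by rewrite -/c !mulgA mulgVK mulgVK; apply: (mulgI v0^-1); rewrite !mulgA E mulVg.
apply: (@cone_eq _ k2 _ _ _ (M' + len v0 + len (gen b) + len c)%N) => g lg.
(* For this [p] the complementation becomes [starts (w y) (e * g) = starts (linv b) g] with
   [e = v0^-1 * c * v0 * gen b], as [cone_eq] requires. *)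
pose p := v0 * (gen b * g).
have lbg := len_mull_ge (gen b) g.
have lp : (M' + len c <= len p)%N.
  move: (len_mull_ge v0 (gen b * g)) lbg lg; rewrite -/p.
  move: (len (gen b * g)) (len p) (len (gen b)) => l1 l2 l3; lia.
have lcp : (M' <= len (c * p)%g)%N.
  by move: (len_mull_ge c p) lp; move: (len (c * p)) (len p) => l1 l2; lia.
have -> : v0^-1 * c * v0 * gen b * g = v0^-1 * (c * p) by rewrite /p !mulgA.
rewrite -(Hw _ _ lcp) fM psiK starts_linv mulKg (Hw p); last by move: lp; lia.
by rewrite /p mulKg -/b [RHS]starts_linv linvK gen_inv linvK.
Qed.

End Automorphisms.

Section Conjugation.
Context {k : nat}.
Local Open Scope group_scope.
Variables (phi : {multiplicative free_group k -> free_group k}) (g : free_group k).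

Definition conj_after (w : free_group k) : free_group k := phi w ^ g.

Lemma conj_afterM : {morph conj_after : u v / u * v}.
Proof. by move=> u v; rewrite /conj_after gmulfM conjMg. Qed.

HB.instance Definition _ := isMultiplicative.Build _ _ conj_after conj_afterM.

End Conjugation.

(** * Lengths and cyclic lengths under automorphisms *)

Section SimpleAutomorphisms.
Context {k : nat}.
Implicit Types phi : {multiplicative free_group k -> free_group k}.
Implicit Types (g h u v w : free_group k) (x y : letter k) (s t : seq (letter k)).
Local Open Scope group_scope.

(* [2k(2k-1)] is the number of reduced words of length 2. *)
Lemma nonsimple_weight (k2 : (2 <= k)%N) phi : bijective phi -> ~ simple_aut phi ->
  exists (m : letter k * letter k -> nat) E,
  [/\ forall ab, (0 < m ab)%N -> no_cancel ab.1 ab.2,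
      forall s, reduced s -> (adjacent_weight m s <= len (phi (of_word s)) + E)%N &
      (2 * k * (2 * k - 1) + 2 * (2 * k - 3) <= \sum_ab m ab)%N].
Proof.
move=> [psi fK psiK] nsimple; have fM := @gmulfM _ _ phi.
have [m [E [m0 mE [H|H]]]] := weighted_length fM fK psiK k2; last by exists m, E.
case: nsimple; have [v0 [w [[sigma wK sigmaK] Hw]]] := cone_like_relabel fM fK psiK k2 H.
(* Applying [phi] to [Hw] gives [phi (gen (w y)) = gen y ^ phi v0]; undoing the conjugation leaves
   the relabeling by the inverse [sigma] of [w]. *)
exists (conj_after phi ((phi v0)^-1)); split; last first.
  by exists (phi v0) => u; rewrite /= /conj_after conjgKV.
split.
  apply: (@bij_comp _ _ _ (fun u => u ^ (phi v0)^-1) phi); last by exists psi.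
  by exists (fun u => u ^ phi v0) => u; rewrite ?conjgKV ?conjgK.
exists (perm (can_inj sigmaK)) => x; rewrite permE /= /conj_after -!/(gen _).
have -> : gen x = v0^-1 * psi (gen (sigma x)) * v0.
  by rewrite Hw sigmaK !mulgA mulVg mul1g mulgVK.
by rewrite !fM psiK (morph_V fM) conjgE invgK !mulgA mulgV mul1g mulgK.
Qed.

Lemma relabeling_len phi w : relabeling phi -> len (phi w) = len w.
Proof.
move=> [_ [s Hs]]; have phiM := @gmulfM _ _ phi.
have Hs' x : phi (gen x) = gen (s x) by exact: Hs.
have sV x : s (linv x) = linv (s x).
  have : phi (gen (linv x)) = (phi (gen x))^-1 by rewrite -gen_inv (morph_V phiM).
  by rewrite !Hs' gen_inv => /(congr1 (@word k)) [].
have phiE t : phi (of_word t) = of_word (map s t).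
  by elim: t => [|x t IHt]; rewrite ?of_word_nil ?(morph_1 phiM) //= !of_word_cons phiM IHt Hs'.
rewrite -{1}(of_wordK w) phiE /len word_of_word ?size_map //.
rewrite /reduced sorted_map (@eq_sorted _ _ no_cancel); first by case: w.
by move=> x y; rewrite /no_cancel /= -sV (inj_eq perm_inj).
Qed.

Lemma len_conj u g : (len (u ^ g)%g <= len u + 2 * len g)%N.
Proof.
rewrite conjgE; apply: leq_trans (len_mul _ _) _; rewrite len_inv.
by apply: leq_trans (leq_add (leqnn _) (len_mul u g)) _; lia.
Qed.

Lemma len_conj_ge u g : (len u <= len (u ^ g)%g + 2 * len g)%N.
Proof. by have := len_conj (u ^ g) g^-1; rewrite conjgK len_inv. Qed.

Lemma simple_aut_len phi : simple_aut phi -> exists D, forall w,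
  (len (phi w) <= len w + D)%N /\ (len w <= len (phi w) + D)%N.
Proof.
move=> [psi [/relabeling_len Hpsi [g Hg]]]; exists (2 * len g)%N => w.
by rewrite Hg -(Hpsi w); split; [exact: len_conj | exact: len_conj_ge].
Qed.

Lemma cyclically_reducedE x s :
  cyclically_reduced (x :: s) = reduced (x :: s) && no_cancel (last x s) x.
Proof. by rewrite /cyclically_reduced /= rcons_path. Qed.

Lemma cyclically_reduced_reduced s : cyclically_reduced s -> reduced s.
Proof. by case: s => // x s; rewrite cyclically_reducedE => /andP[]. Qed.

Lemma reduced_nseq s n : cyclically_reduced s -> reduced (flatten (nseq n s)).
Proof.
case: s => [|x t]; first by elim: n.
rewrite cyclically_reducedE => /andP[/= rt lx].
have H : path no_cancel (last x t) (flatten (nseq n (x :: t))).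
  by elim: n => //= n IHn; rewrite lx cat_path rt.
exact: path_sorted H.
Qed.

Lemma word_pow w n : cyclically_reduced w -> word (w ^+ n) = flatten (nseq n (word w)).
Proof.
move=> cw; suff -> : w ^+ n = of_word (flatten (nseq n (word w))) by rewrite word_of_word // reduced_nseq.
by elim: n => //= n IHn; rewrite expgS of_word_cat of_wordK IHn.
Qed.

Lemma len_pow w n : cyclically_reduced w -> len (w ^+ n) = (n * len w)%N.
Proof.
move=> cw; rewrite /len word_pow // size_flatten /shape map_nseq sumn_nseq; lia.
Qed.

Lemma cyclically_reduced_conj w : exists v, cyclically_reduced v /\ exists g, v = w ^ g.
Proof.
move: {2}(len w) (leqnn (len w)) => n; elim: n w => [|n IHn] w lw.
  by exists w; split; [case: w lw => [[|]] | exists 1; rewrite conjg1].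
have [cw|ncw] := boolP (cyclically_reduced w); first by exists w; split=> //; exists 1; rewrite conjg1.
case: w lw ncw => [[|x s] rs] // lw; rewrite cyclically_reducedE rs /=.
case/lastP: s rs lw => [|s y] rs lw.
  by rewrite no_cancel_refl.
rewrite last_rcons /no_cancel negbK => /eqP xy; set w := FreeGroup rs.
have wE : w = of_word s ^ (gen x)^-1.
  rewrite -(of_wordK w) /= of_word_cons of_word_rcons conjgE invgK gen_inv xy linvK.
  by [].
have [|v [cv [g vE]]] := IHn (of_word s).
  move: lw; rewrite /len /= size_rcons => /ltnW; rewrite ltnS.
  exact: leq_trans (size_reduce _).
exists v; split=> //; exists (gen x * g).
by rewrite conjgM wE conjgKV.
Qed.

(** [cyclic_len] is the translation length on the tree: powers of a cyclically reduced conjugate do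
    not cancel, and conjugating changes lengths by an amount independent of [n]. Length estimates
    with additive errors thus become exact for [cyclic_len]. *)
Lemma cyclic_len_pow w : exists E, forall n,
  (len (w ^+ n) <= n * cyclic_len w + E)%N /\ (n * cyclic_len w <= len (w ^+ n) + E)%N.
Proof.
have [v cE [cv [g vE]]] : exists2 v, cyclic_len w = len v &
    cyclically_reduced v /\ exists g, v = w ^ g.
  rewrite /cyclic_len; set P := (X in xget w X).
  have [] : P (xget w P).
    by apply: xgetPex; have [v [cv [g vE]]] := cyclically_reduced_conj w;
      exists v; split=> //; exists g; rewrite vE.
  by move=> cv [g vE]; exists (xget w P) => //; split=> //; exists g; exact: word_inj.
exists (2 * len g)%N => n; rewrite cE -(len_pow n cv) vE -conjXg.
by split; [exact: len_conj_ge | exact: len_conj].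
Qed.

Lemma leq_asymptotic (a b E : nat) : (forall n, (n * a <= n * b + E)%N) -> (a <= b)%N.
Proof. by move=> H; rewrite leqNgt; apply/negP => ba; have := H E.+1; nia. Qed.

Lemma archimedean_le0 (R : realType) (c B : R) :
  (forall n : nat, n%:R * c <= B)%R -> (c <= 0)%R.
Proof.
move=> H; rewrite leNgt; apply/negP => c0.
have := truncnS_gt (B / c); rewrite ltr_pdivrMr // ltNge H //.
Qed.

Lemma cyclic_len_id w : cyclically_reduced w -> cyclic_len w = len w.
Proof.
move=> cw; have [E HE] := cyclic_len_pow w; apply/eqP; rewrite eqn_leq.
by apply/andP; split; apply: (@leq_asymptotic _ _ E) => n; have := HE n; rewrite len_pow // => -[].
Qed.

Lemma simple_aut_cyclic_len phi w : simple_aut phi -> cyclic_len (phi w) = cyclic_len w.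
Proof.
move=> /simple_aut_len[D HD].
have [E HE] := cyclic_len_pow w; have [E' HE'] := cyclic_len_pow (phi w).
have H n : phi (w ^+ n) = phi w ^+ n by rewrite (morph_X (@gmulfM _ _ phi)).
apply/eqP; rewrite eqn_leq.
by apply/andP; split; apply: (@leq_asymptotic _ _ (E + E' + D)%N) => n;
  have := HE n; have := HE' n; have := HD (w ^+ n); rewrite H; lia.
Qed.

Lemma adjacent_weight_cons m x y s :
  adjacent_weight m (x :: y :: s) = (m (x, y) + adjacent_weight m (y :: s))%N.
Proof. by rewrite /adjacent_weight /= big_cons. Qed.

Lemma adjacent_weight_cat m s t :
  (adjacent_weight m s + adjacent_weight m t <= adjacent_weight m (s ++ t))%N.
Proof.
elim: s => [|x s IHs]; first by rewrite /adjacent_weight big_nil.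
case: s IHs => [|y s] IHs.
  rewrite {1}/adjacent_weight big_nil add0n.
  case: t {IHs} => [|y t]; last by rewrite /= adjacent_weight_cons leq_addl.
  by rewrite {1}/adjacent_weight big_nil.
by rewrite adjacent_weight_cons /= adjacent_weight_cons -addnA leq_add2l.
Qed.

Lemma adjacent_weight_nseq m s n :
  (n * adjacent_weight m s <= adjacent_weight m (flatten (nseq n s)))%N.
Proof.
elim: n => //= n IHn; apply: leq_trans (adjacent_weight_cat m s _).
by rewrite mulSn leq_add2l.
Qed.

Lemma adjacent_weight_count m s :
  adjacent_weight m s = (\sum_ab m ab * count_mem ab (adjacent_pairs s))%N.
Proof.
rewrite /adjacent_weight; elim: (adjacent_pairs s) => [|p l IHl].
  by rewrite big_nil big1 // => ab _; rewrite muln0.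
rewrite big_cons IHl [RHS](eq_bigr (fun ab => m ab * (p == ab) + m ab * count_mem ab l)%N).
  rewrite big_split /=; congr addn; rewrite (bigD1 p) //= eqxx muln1 big1 ?addn0 //.
  by move=> q /negPf; rewrite eq_sym => ->; rewrite muln0.
by move=> ab _; rewrite /= mulnDr.
Qed.

(** Apply the estimate to the powers of [w] and divide by the exponent: the additive error
    disappears. *)
Lemma weight_cyclic_len phi m E w : cyclically_reduced w ->
  (forall s, reduced s -> (adjacent_weight m s <= len (phi (of_word s)) + E)%N) ->
  (adjacent_weight m w <= cyclic_len (phi w))%N.
Proof.
move=> cw Hm; have [E' HE'] := cyclic_len_pow (phi w).
apply: (@leq_asymptotic _ _ (E + E')%N) => n.
apply: leq_trans (adjacent_weight_nseq m w n) _.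
apply: leq_trans (Hm _ (reduced_nseq n cw)) _.
rewrite -word_pow // of_wordK (morph_X (@gmulfM _ _ phi)) (addnC E) addnA leq_add2r.
exact: (HE' n).1.
Qed.

(** A rough similarity multiplies translation lengths by exactly [l]. Testing on a generator shows
    that [l] is a natural number, testing on its preimage that [l] divides 1; hence [l = 1]. *)
Lemma rough_similarity_cyclic_len (k2 : (2 <= k)%N) (R : realType) phi : bijective phi ->
  rough_similarity (@word_dist k R) (@word_dist k R) phi ->
  forall w, cyclic_len (phi w) = cyclic_len w.
Proof.
move=> [psi phiK psiK] [l [D [l0 D0 HD]]].
have phiM := @gmulfM _ _ phi.
have {}HD u : (`|(len (phi u))%:R - l * (len u)%:R| <= D)%R.
  by have := HD 1 u; rewrite /word_dist -morph_V // -phiM invg1 mul1g.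
have ll w : ((cyclic_len (phi w))%:R = l * (cyclic_len w)%:R)%R.
  have [E HE] := cyclic_len_pow w; have [E' HE'] := cyclic_len_pow (phi w).
  set a := cyclic_len (phi w); set b := cyclic_len w.
  apply/eqP; rewrite -subr_eq0 -normr_eq0 eq_le normr_ge0 andbT.
  apply: (@archimedean_le0 _ _ (D + l * E%:R + E'%:R)%R) => n.
  have := HD (w ^+ n); rewrite morph_X //.
  have [] := HE' n; have [] := HE n; rewrite -!(ler_nat R) !natrD !natrM -/a -/b.
  move: (len (phi w ^+ n)%g) (len (w ^+ n)%g) => P Q Q1 Q2 P1 P2.
  have lQ1 := ler_wpM2l (ltW l0) Q1; have lQ2 := ler_wpM2l (ltW l0) Q2.
  rewrite -[n%:R%R]normr_nat -normrM !ler_norml => /andP[S1 S2].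
  by apply/andP; split; nra.
pose x0 : letter k := (Ordinal (ltnW k2), false).
have c1 : cyclic_len (gen x0) = 1%N.
  by rewrite cyclic_len_id // /cyclically_reduced /= no_cancel_refl.
have la := ll (gen x0); have lb := ll (psi (gen x0)).
rewrite psiK c1 in la lb; rewrite mulr1 in la.
move: lb; rewrite -la -natrM => /eqP; rewrite eqr_nat => /eqP/esym/eqP; rewrite muln_eq1 => /andP[/eqP l1 _].
by move=> w; apply/eqP; rewrite -(eqr_nat R) ll -la l1 mul1r.
Qed.

End SimpleAutomorphisms.

(** * Frequencies of two-letter subwords *)

Section TupleSums.

Lemma sum_tuple_cons (V : nmodType) (T : finType) n (P : pred (seq T)) (F : seq T -> V) :
  \sum_(t : n.+1.-tuple T | P t) F t =
  \sum_x \sum_(t : n.-tuple T | P (x :: t)) F (x :: t).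
Proof.
rewrite pair_big_dep /= (reindex (fun p : T * n.-tuple T => [tuple of p.1 :: p.2])) //=.
exists (fun t : n.+1.-tuple T => (thead t, [tuple of behead t])) => [[x t] _|t _] /=.
  by rewrite theadE; congr pair; apply: val_inj.
by rewrite [RHS]tuple_eta; apply: val_inj.
Qed.

Lemma sum_tuple_path (V : nmodType) (T : finType) (e : rel T) (P : pred (seq T)) n z
    (F : seq T -> V) :
  \sum_(t : n.+1.-tuple T | path e z t && P t) F t =
  \sum_(y | e z y) \sum_(t : n.-tuple T | path e y t && P (y :: t)) F (y :: t).
Proof.
rewrite (sum_tuple_cons n (fun t => path e z t && P t)) [RHS]big_mkcond; apply: eq_bigr => y _ /=.
by case: ifP => zy; [exact: eq_bigl|exact: big_pred0].
Qed.

Lemma card_tupleE (R : pzRingType) (T : finType) n (P : pred (n.-tuple T)) :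
  #|[pred t | P t]|%:R = \sum_(t : n.-tuple T | P t) 1 :> R.
Proof. by rewrite -sum1_card natr_sum; apply: eq_bigl => t; rewrite !inE. Qed.

End TupleSums.

Section Concentration.
Context {k : nat} {R : realType}.
Implicit Types (x y z : letter k) (s t : seq (letter k)).

Local Notation q := (2 * k%:R - 1 : R).

Definition occurrences (ab : letter k * letter k) s : nat :=
  count_mem ab (adjacent_pairs s).

Lemma occurrences_cons ab x y s :
  occurrences ab (x :: y :: s) = (((x, y) == ab) + occurrences ab (y :: s))%N.
Proof. by []. Qed.

Lemma sum_no_cancel z (F : letter k -> R) :
  \sum_(y | no_cancel z y) F y = \sum_y F y - F (linv z).
Proof. by rewrite [in RHS](bigD1 (linv z)) //= [RHS]addrAC subrr add0r. Qed.

Lemma card_no_cancel z : (#|[pred y | no_cancel z y]|)%:R = q.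
Proof.
rewrite -sum1_card natr_sum (eq_bigl (no_cancel z)) => [|y]; last by rewrite inE.
by rewrite (sum_no_cancel z (fun=> 1)) sumr_const card_letter natrM.
Qed.

Hypothesis k2 : (2 <= k)%N.

Lemma k2R : 2 <= k%:R :> R.
Proof. by rewrite ler_nat. Qed.

Variable ab : letter k * letter k.
Hypothesis nc : no_cancel ab.1 ab.2.
Local Notation a := ab.1.
Local Notation m := (2 * k%:R * (2 * k%:R - 1) : R)^-1.

(* Solution of the Poisson equation [q g z + g (z^-1) = 1/2k - [z = a]]: the first
   order perturbation of the constant eigenvector of the transfer operator when the
   transition [ab] is given weight [1 - delta]. *)
Definition poisson z : R := (4 * k%:R ^+ 2)^-1 +
  ((z == linv a)%:R - q * (z == a)%:R) / (q ^+ 2 - 1).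

Lemma poissonE z : q * poisson z + poisson (linv z) = (2 * k%:R)^-1 - (z == a)%:R.
Proof.
have := k2R; rewrite /poisson (can_eq linvK) -(can2_eq linvK linvK).
move: (linv z == a)%:R (z == a)%:R k%:R => u v K K2.
by field; apply/andP; split; apply: lt0r_neq0; nra.
Qed.

Lemma sum_poisson : \sum_z poisson z = 0.
Proof.
have := k2R; rewrite /poisson big_split /= sumr_const card_letter -mulr_suml sumrB -mulr_sumr.
have sum1 x : \sum_z (z == x)%:R = 1 :> R.
  by rewrite (bigD1 x) //= eqxx big1 ?addr0 // => z /negPf ->.
rewrite !sum1 -[_ *+ (2 * k)]mulr_natr natrM; move: k%:R => K K2.
by field; apply/andP; split; apply: lt0r_neq0; nra.
Qed.

Lemma poisson_bound z : - 2^-1 <= poisson z <= 2^-1.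
Proof.
have := k2R; rewrite /poisson; set Q := q ^+ 2 - 1; move: k%:R @Q => K /= K2.
have K0 : 0 < 4 * K ^+ 2 by nra.
have Q0 : 0 < (2 * K - 1) ^+ 2 - 1 by nra.
have [u0 u1] : 0 <= (4 * K ^+ 2)^-1 /\ (4 * K ^+ 2)^-1 <= 16^-1.
  by split; [rewrite invr_ge0 ltW | rewrite lef_pV2 ?posrE //; nra].
set w := (_ - _) / _; suff /andP[w0 w1] : - (3 / 8) <= w <= 8^-1 by apply/andP; split; lra.
rewrite /w ler_pdivrMr // ler_pdivlMr //.
by case: (z == linv a); case: (z == a); rewrite ?mulr1n ?mulr0n; apply/andP; split; nra.
Qed.

Section Transfer.
Variable delta : R.
Hypothesis delta01 : 0 < delta <= 1.

(** [h] is an approximate eigenvector of the transfer operator; [rho] is its eigenvalue to first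
    order in [delta], with the term [delta ^+ 2] absorbing the error. *)
Let h z := 1 + delta * poisson z.
Let rho := q * (1 - delta * m + delta ^+ 2).

Lemma h_bound z : 2^-1 <= h z <= 3 / 2.
Proof.
case/andP: delta01 => d0 d1; case/andP: (poisson_bound z) => p0 p1.
by rewrite /h; apply/andP; split; nra.
Qed.

Lemma m_bound : 0 < m <= 12^-1.
Proof.
have := k2R; move: k%:R => K K2; rewrite invr_gt0 lef_pV2 ?posrE; [|nra|lra].
by apply/andP; split; nra.
Qed.

Lemma rho_gt0 : 0 < rho.
Proof.
case/andP: delta01 => d0 d1; case/andP: m_bound => m0 m1.
have q0 : 3 <= q by have := k2R; lra.
by rewrite /rho mulr_gt0 //; [lra|nra].
Qed.

(** By [poissonE] and [sum_poisson] the terms of order 0 and 1 in [delta] cancel; what remains is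
    [delta ^+ 2] times a quantity that the bounds on [poisson] make positive. *)
Lemma transfer_le z :
  \sum_(y | no_cancel z y) (if (z, y) == ab then 1 - delta else 1) * h y <= rho * h z.
Proof.
have -> : \sum_(y | no_cancel z y) (if (z, y) == ab then 1 - delta else 1) * h y =
    \sum_(y | no_cancel z y) h y - delta * (z == a)%:R * h ab.2.
  transitivity (\sum_(y | no_cancel z y) (h y - delta * (z == a)%:R * h ab.2 * (y == ab.2)%:R)).
    apply: eq_bigr => y _; rewrite -pair_eqE /pair_eq /=.
    by case: (z =P a) => _; case: (y =P ab.2) => [->|_] /=; ring.
  rewrite sumrB -mulr_sumr; case: (z =P a) => [->|_]; last by rewrite !(mulr0, mul0r).
  rewrite [X in _ - _ * X](_ : _ = 1) ?mulr1 // (bigD1 ab.2) //= eqxx.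
  by rewrite big1 ?addr0 // => y /andP[_ /negPf ->].
rewrite sum_no_cancel /h big_split /= sumr_const card_letter -mulr_sumr sum_poisson.
have := poissonE z; rewrite /rho.
case/andP: delta01 => d0 d1; case/andP: (poisson_bound z); case/andP: (poisson_bound ab.2).
case/andP: m_bound.
have -> : (2 * k%:R)^-1 = q * m.
  by have := k2R; move: k%:R => K K2; field; apply/andP; split; apply: lt0r_neq0; nra.
have -> : (2 * k)%:R = q + 1 :> R by rewrite natrM; lra.
have : 3 <= q by have := k2R; lra.
move: (poisson z) (poisson (linv z)) (poisson ab.2) q m => p p' pb Q M Q3 M0 M1 b0 b1 p0 p1 E.
have z0 : 0 <= (z == a)%:R :> R by [].
have z1 : (z == a)%:R <= 1 :> R by case: (z == a).
move: (z == a)%:R E z0 z1 => v E v0 v1.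
have -> : p' = Q * M - v - Q * p by lra.
rewrite -subr_ge0.
have -> : Q * (1 - delta * M + delta ^+ 2) * (1 + delta * p) -
   (Q + 1 + delta * 0 - (1 + delta * (Q * M - v - Q * p)) - delta * v * (1 + delta * pb))
   = delta ^+ 2 * (Q * (1 - M * p + delta * p) + v * pb) by ring.
rewrite mulr_ge0 ?sqr_ge0 //.
have H1 : 4^-1 <= 1 - M * p + delta * p.
  have : 0 <= M * (2^-1 - p) by rewrite mulr_ge0 //; lra.
  have : 0 <= delta * (p + 2^-1) by rewrite mulr_ge0 //; lra.
  lra.
have H2 : - 2^-1 <= v * pb.
  have : 0 <= v * (pb + 2^-1) by rewrite mulr_ge0 //; lra.
  lra.
by nra.
Qed.

(** Iterate [transfer_le]; the factor 2 comes from starting with [1 <= 2 * h z]. *)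
Lemma transfer_pow n z :
  \sum_(t : n.-tuple (letter k) | path no_cancel z t) (1 - delta) ^+ occurrences ab (z :: t)
  <= 2 * rho ^+ n * h z.
Proof.
elim: n z => [|n IHn] z.
  rewrite (big_pred1 [tuple]) => [|t]; last by rewrite tuple0 /= eqxx.
  by rewrite expr0 /= /occurrences /= expr0; case/andP: (h_bound z); lra.
rewrite (eq_bigl (fun t : n.+1.-tuple _ => path no_cancel z t && predT (val t))); last first.
  by move=> t; rewrite andbT.
rewrite (@sum_tuple_path _ _ no_cancel predT n z (fun t => (1 - delta) ^+ occurrences ab (z :: t))).
apply: le_trans (_ : \sum_(y | no_cancel z y)
    (if (z, y) == ab then 1 - delta else 1) * (2 * rho ^+ n * h y) <= _).
  apply: ler_sum => y _; apply: le_trans (ler_wpM2l _ (IHn y)); last first.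
    by case: ifP => _ //; case/andP: delta01; lra.
  rewrite mulr_sumr (eq_bigl (fun t : n.-tuple _ => path no_cancel y t)); last first.
    by move=> t; rewrite andbT.
  by apply: ler_sum => t _; rewrite occurrences_cons exprD; case: ifP; rewrite ?expr1 ?expr0.
have -> : \sum_(y | no_cancel z y)
    (if (z, y) == ab then 1 - delta else 1) * (2 * rho ^+ n * h y) =
    2 * rho ^+ n * \sum_(y | no_cancel z y) (if (z, y) == ab then 1 - delta else 1) * h y.
  by rewrite mulr_sumr; apply: eq_bigr => y _; ring.
have -> : 2 * rho ^+ n.+1 * h z = 2 * rho ^+ n * (rho * h z).
  by rewrite exprSr [RHS]mulrA; congr (_ * _); rewrite mulrA.
by rewrite ler_pM2l ?transfer_le // mulr_gt0 ?exprn_gt0 ?rho_gt0.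
Qed.

End Transfer.

(* Exponential Markov inequality for the weight [(1 - delta) ^ occurrences]. *)
Lemma few_occurrences theta : 0 < theta < m -> exists D sigma : R,
  [/\ 0 < D, 0 < sigma < 1 & forall n, (0 < n)%N ->
    #|[pred t : n.-tuple (letter k) | reduced t &&
        ((occurrences ab t)%:R < theta * n%:R)]|%:R <= D * (sigma * q) ^+ n].
Proof.
case/andP=> th0 thm; case/andP: m_bound => m0 m1.
(* Then [m - theta = 2 delta]: half of the gap pays for the second-order error. *)
pose delta := (m - theta) / 2.
have d01 : 0 < delta <= 1 by rewrite /delta; apply/andP; split; lra.
case/andP: (d01) => d0 d1.
have q0 : 3 <= q by have := k2R; lra.
(* Chosen so that [1 + tau] is the inverse of [1 - delta], whence [expR (- tau) <= 1 - delta]. *)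
pose tau := delta / (1 - delta).
have d1' : 0 < 1 - delta by rewrite /delta; lra.
have tau0 : 0 < tau by rewrite divr_gt0.
pose r := 1 - delta * m + delta ^+ 2.
have r0 : 0 < r by rewrite /r; nra.
pose beta := expR (- (tau * theta)).
have b0 : 0 < beta by exact: expR_gt0.
have weight N n : N%:R < theta * n%:R -> beta ^+ n <= (1 - delta) ^+ N.
  move=> Nn; have dt : expR (- tau) <= 1 - delta.
    rewrite expRN invf_ple ?posrE ?expR_gt0 //; apply: le_trans (expR_ge1Dx _).
    by rewrite /tau -lerBlDl le_eqVlt; apply/orP; left; apply/eqP; field; apply: lt0r_neq0.
  apply: le_trans (lerXn2r N _ _ dt); rewrite ?nnegrE ?expR_ge0 ?(ltW d1') //.
  by rewrite -!expRM_natl ler_expR; nra.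
(* There are [2k] first letters, each contributing a factor [2 * h <= 3]; a word of length [n.+1]
   has only [n] transitions, which accounts for dividing by [r * q]. *)
exists (2 * k%:R * 3 / (r * q)), (r / beta); split.
- by rewrite divr_gt0 ?mulr_gt0 //; have := k2R; lra.
- rewrite divr_gt0 //= ltr_pdivrMr // mul1r.
  apply: le_lt_trans (_ : expR (- (delta * m) + delta ^+ 2) < _).
    by apply: le_trans (expR_ge1Dx _); rewrite /r; lra.
  rewrite ltr_expR; suff : tau * theta < delta * m - delta ^+ 2 by lra.
  rewrite /tau -mulrA [_^-1 * _]mulrC mulrA ltr_pdivrMr //.
  rewrite -subr_gt0.
  have -> : (delta * m - delta ^+ 2) * (1 - delta) - delta * theta =
            delta * (m - theta - delta - delta * m + delta ^+ 2) by ring.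
  by rewrite mulr_gt0 //; rewrite /delta; nra.
case=> // n _; rewrite card_tupleE.
rewrite (_ : (r / beta * q) ^+ n.+1 = (r * q) * (r * q) ^+ n / beta ^+ n.+1); last first.
  by rewrite -exprS -exprVn -exprMn; congr (_ ^+ _); ring.
rewrite mulrA ler_pdivlMr ?exprn_gt0 // mulr_suml.
apply: le_trans (_ : \sum_(t : n.+1.-tuple (letter k) | reduced t)
    (1 - delta) ^+ occurrences ab t <= _).
  rewrite [leRHS]big_mkcond [leLHS]big_mkcond; apply: ler_sum => t _.
  case: (reduced t) => //=; case: ifP => [/weight|_]; first by rewrite mul1r.
  by rewrite exprn_ge0 // ltW.
rewrite (sum_tuple_cons n (fun t => reduced t) (fun t => (1 - delta) ^+ occurrences ab t)).
apply: le_trans (_ : \sum_(x : letter k) 3 * (q * r) ^+ n <= _).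
  apply: ler_sum => x _; apply: le_trans (transfer_pow d01 n x) _.
  rewrite -/r; case/andP: (h_bound d01 x) => _ hx.
  have rn : 0 <= (q * r) ^+ n by rewrite exprn_ge0 // mulr_ge0 ?ltW //; lra.
  by have := ler_wpM2l rn hx; lra.
rewrite sumr_const card_letter -[leLHS]mulr_natl natrM [r * q]mulrC.
rewrite le_eqVlt; apply/orP; left; apply/eqP; field.
by rewrite gt_eqF //=; apply: lt0r_neq0; lra.
Qed.

End Concentration.

(** * An exponentially generic set of cyclically reduced words *)

Section Genericity.
Context {k : nat} {R : realType}.
Hypothesis k2 : (2 <= k)%N.
Local Notation q := (2 * k%:R - 1 : R).
Local Notation m := (2 * k%:R * (2 * k%:R - 1) : R)^-1.

(** All letters but the last can be chosen in [q] ways each, and for the last one some letter avoids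
    both forbidden values. *)
Lemma closing_paths x n z : q ^+ n <=
  \sum_(t : n.+1.-tuple (letter k) | path no_cancel z t && no_cancel (last z t) x) 1 :> R.
Proof.
have K2 := k2R (R := R) k2.
elim: n z => [|n IHn] z.
  rewrite expr0 (@sum_tuple_path _ _ no_cancel (fun t => no_cancel (last z t) x) 0 z (fun=> 1)).
  have [y /andP[yz yx]] := letter_avoid k2 (linv z) (linv x).
  have zy : no_cancel z y by exact: yz.
  have yx' : no_cancel y x by apply: contraNneq yx => ->; rewrite linvK eqxx.
  rewrite (bigD1 y) //= (big_pred1 [tuple]) => [|t]; last by rewrite tuple0 /= yx' eqxx.
  by rewrite lerDl sumr_ge0 // => y' _; rewrite sumr_ge0.
rewrite (@sum_tuple_path _ _ no_cancel (fun t => no_cancel (last z t) x) n.+1 z (fun=> 1)) /=.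
apply: le_trans (_ : \sum_(y | no_cancel z y) q ^+ n <= _); last first.
  by apply: ler_sum => y _; exact: IHn.
by rewrite sumr_const -[leRHS]mulr_natl exprS ler_wpM2r ?exprn_ge0 ?card_no_cancel //; lra.
Qed.

(** A lower bound of the same exponential order as the number of reduced words, so that sets
    negligible among reduced words stay negligible here. *)
Lemma cyclically_reduced_count n : (0 < n)%N ->
  q ^+ n.-1 <= #|[pred t : n.-tuple (letter k) | cyclically_reduced t]|%:R.
Proof.
have K2 := k2R (R := R) k2.
have -> : #|[pred t : n.-tuple (letter k) | cyclically_reduced t]|%:R =
  \sum_(t : n.-tuple (letter k) | cyclically_reduced t) 1 :> R by exact: card_tupleE.
case: n => [|[|n]] // _.
  rewrite expr0 (sum_tuple_cons 0 (fun t => cyclically_reduced t) (fun=> 1)).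
  pose x0 : letter k := (Ordinal (ltnW k2), false).
  have c0 : cyclically_reduced [:: x0].
    by rewrite cyclically_reducedE; exact: no_cancel_refl.
  rewrite (bigD1 x0) //= (big_pred1 [tuple]) => [|t]; last first.
    by rewrite tuple0 [RHS]/= [RHS]eqxx; exact: c0.
  by rewrite lerDl sumr_ge0 // => y' _; rewrite sumr_ge0.
rewrite (sum_tuple_cons n.+1 (fun t => cyclically_reduced t) (fun=> 1)).
apply: le_trans (_ : \sum_(x : letter k) q ^+ n <= _); last first.
  apply: ler_sum => x _; apply: le_trans (closing_paths x n x) _.
  by rewrite (eq_bigl _ _ (fun t : n.+1.-tuple (letter k) => cyclically_reducedE x t)).
rewrite sumr_const card_letter -[leRHS]mulr_natl natrM /= exprS ler_wpM2r ?exprn_ge0 //; lra.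
Qed.

(** The trivial word is excluded because it satisfies the length conditions for every
    automorphism. *)
Definition frequent (theta : R) : set (free_group k) := [set w : free_group k |
  [/\ cyclically_reduced w, w != 1%g &
    forall ab, no_cancel ab.1 ab.2 -> theta * (len w)%:R <= (occurrences ab w)%:R]].

(** Union bound: a cyclically reduced word of positive length outside the set is a reduced word in
    which one of finitely many pairs is rare. *)
Lemma frequent_generic (theta : R) : 0 < theta < m -> exp_CR_generic R (frequent theta).
Proof.
have K2 := k2R (R := R) k2 => th; split; first by move=> w [].
have /choice[D /choice[sigma HD]] : forall ab : letter k * letter k,
    exists D sigma : R, no_cancel ab.1 ab.2 -> [/\ 0 < D, 0 < sigma < 1 & forall n, (0 < n)%N ->
    #|[pred t : n.-tuple (letter k) | reduced t &&
        ((occurrences ab t)%:R < theta * n%:R)]|%:R <= D * (sigma * q) ^+ n].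
  move=> ab; have [nc|/negP nc] := boolP (no_cancel ab.1 ab.2); last by exists 0, 0.
  by have [D [sigma H]] := few_occurrences k2 nc th; exists D, sigma.
pose P := [pred ab : letter k * letter k | no_cancel ab.1 ab.2].
(* The initial value [2^-1] keeps the maximum strictly between 0 and 1. *)
pose s := \big[Num.max/2^-1]_(ab | P ab) sigma ab.
have s0 : 0 < s by rewrite /s; elim/big_ind: _ => [|u v u0 v0|ab /HD[_ /andP[]]] //; rewrite lt_max u0.
have s1 : s < 1.
  rewrite /s; elim/big_ind: _ => [|u v u0 v0|ab /HD[_ /andP[]]] //; first by lra.
  by rewrite gt_max u0.
have sab ab : P ab -> sigma ab <= s by move=> Pab; rewrite /s le_bigmax_cond.
(* The factor [q] compares [q ^+ n] with the lower bound [q ^+ n.-1]; the summand 1 ensures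
   positivity. *)
pose D1 := 1 + q * \sum_(ab | P ab) D ab.
have D0 : 0 <= \sum_(ab | P ab) D ab by apply: sumr_ge0 => ab /HD[/ltW].
have D10 : 0 < D1 by rewrite /D1; nra.
exists D1, s; split; rewrite ?s0 // => n n0.
rewrite /CR_prob; set A := #|_|; set B := #|_|.
have B0 : 0 < B%:R :> R.
  by apply: lt_le_trans (cyclically_reduced_count n0); rewrite exprn_gt0; lra.
have AB : (B%:R - A%:R : R) <= \sum_(ab | P ab) D ab * (sigma ab * q) ^+ n.
  apply: le_trans (_ : \sum_(ab | P ab) #|[pred t : n.-tuple (letter k) | reduced t &&
        ((occurrences ab t)%:R < theta * n%:R)]|%:R <= _); last first.
    by apply: ler_sum => ab /HD[_ _]; apply.
  rewrite lerBlDl -natr_sum -natrD ler_nat.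
  have -> : (\sum_(ab | P ab) #|[pred t : n.-tuple (letter k) | reduced t &&
        ((occurrences ab t)%:R < theta * n%:R)%R]| = 
     \sum_(t : n.-tuple (letter k)) \sum_(ab | P ab)
       (reduced t && ((occurrences ab t)%:R < theta * n%:R)%R))%N.
    rewrite exchange_big; apply: eq_bigr => ab _; rewrite -sum1_card big_mkcond.
    by apply: eq_bigr => t _; rewrite inE; case: ifP.
  rewrite /A /B -!sum1_card !(big_mkcond (fun _ => _ \in _)) -big_split /=.
  apply: leq_sum => t _; rewrite !inE.
  have [ct|//] := boolP (cyclically_reduced t); rewrite /=.
  case: asboolP => //= nC.
  have rt := cyclically_reduced_reduced ct.
  have [|] := boolP [exists ab, P ab && ((occurrences ab t)%:R < theta * n%:R)%R].
    by move=> /existsP[ab /andP[Pab lt]]; rewrite (bigD1 ab) //= rt lt.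
  rewrite negb_exists => /forallP H; case: nC; rewrite /frequent /mkset /len word_of_word //.
  split=> //.
    apply: contraTneq n0 => /(congr1 (@word k)); rewrite word_of_word // => t0.
    by rewrite -(size_tuple t) t0.
  by move=> ab Pab; have := H ab; rewrite [P ab]Pab /= -leNgt size_tuple.
have AleB : A%:R <= B%:R :> R.
  by rewrite ler_nat; apply/subset_leq_card/fintype.subsetP => t; rewrite !inE => /andP[].
have -> : A%:R / B%:R - 1 = - ((B%:R - A%:R) / B%:R) :> R.
  by field; rewrite gt_eqF.
rewrite normrN ger0_norm; last by rewrite divr_ge0 ?subr_ge0 // ltW.
rewrite ler_pdivrMr //.
have q0 : 0 < q by lra.
have qn : 0 < q ^+ n.-1 by rewrite exprn_gt0.
have sn : 0 < s ^+ n by rewrite exprn_gt0.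
apply: le_trans (_ : D1 * s ^+ n * q ^+ n.-1 <= _); last first.
  by rewrite ler_pM2l ?mulr_gt0 // cyclically_reduced_count.
apply: le_trans AB _.
apply: le_trans (_ : \sum_(ab | P ab) D ab * (s * q) ^+ n <= _).
  apply: ler_sum => ab Pab; have [Dab /andP[sab0 _] _] := HD _ Pab.
  by rewrite ler_pM2l // lerXn2r ?nnegrE ?mulr_ge0 ?(ltW sab0) ?(ltW s0) ?(ltW q0) // ler_pM2r // sab.
rewrite -mulr_suml exprMn -{2}(prednK n0) exprS /D1.
rewrite -subr_ge0; set S := \sum_(ab | _) _ in D0 *.
have -> : (1 + q * S) * s ^+ n * q ^+ n.-1 - S * (s ^+ n * (q * q ^+ n.-1)) = s ^+ n * q ^+ n.-1 by ring.
by rewrite mulr_ge0 // ltW.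
Qed.

End Genericity.

(** * Averages over reduced words and over the boundary *)

Section AverageWeight.
Context {k : nat} {R : realType}.
Local Notation q := (2 * k%:R - 1 : R).

Lemma sum_paths n (z : letter k) :
  \sum_(t : n.-tuple (letter k) | path no_cancel z t) 1 = q ^+ n :> R.
Proof.
elim: n z => [|n IHn] z.
  by rewrite (big_pred1 [tuple]) => [|t]; rewrite ?tuple0 //= eqxx.
rewrite (eq_bigl (fun t : n.+1.-tuple _ => path no_cancel z t && predT (val t))); last first.
  by move=> t; rewrite andbT.
rewrite (@sum_tuple_path _ _ no_cancel predT n z (fun=> 1)).
rewrite (eq_bigr (fun=> q ^+ n)) => [|y _]; last first.
  by rewrite -(IHn y); apply: eq_bigl => t; rewrite andbT.
by rewrite sumr_const -[LHS]mulr_natl exprS card_no_cancel.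
Qed.

(** The pair can sit at [n] places, and each placement leaves [n.-1] letters with [q] choices each.
    For [n = 0] the truncated exponent is harmless, as the first factor vanishes. *)
Lemma sum_occurrences (ab : letter k * letter k) n : no_cancel ab.1 ab.2 ->
  \sum_(z : letter k) \sum_(t : n.-tuple (letter k) | path no_cancel z t)
    (occurrences ab (z :: t))%:R = n%:R * q ^+ n.-1 :> R.
Proof.
move=> nc; elim: n => [|n IHn].
  rewrite mul0r big1 // => z _; rewrite (big_pred1 [tuple]) // => t.
  by rewrite tuple0 /= eqxx.
pose S z := \sum_(t : n.-tuple (letter k) | path no_cancel z t) (occurrences ab (z :: t))%:R : R.
transitivity (\sum_z \sum_(y | no_cancel z y) (((z, y) == ab)%:R * q ^+ n + S y)).
  apply: eq_bigr => z _.
  rewrite (eq_bigl (fun t : n.+1.-tuple _ => path no_cancel z t && predT (val t))); last first.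
    by move=> t; rewrite andbT.
  rewrite (@sum_tuple_path _ _ no_cancel predT n z (fun t => (occurrences ab (z :: t))%:R)).
  apply: eq_bigr => y _; rewrite /S -(sum_paths n y) mulr_sumr -big_split /=.
  apply: eq_big => [t|t _]; first by rewrite andbT.
  by rewrite occurrences_cons natrD mulr1.
rewrite (exchange_big_dep xpredT) //=.
transitivity (\sum_y ((y == ab.2)%:R * q ^+ n + q * S y)).
  apply: eq_bigr => y _; rewrite big_split /=; congr (_ + _).
    rewrite -mulr_suml; congr (_ * _).
    have [->|yb] := eqVneq y ab.2.
      rewrite (bigD1 ab.1) //= -surjective_pairing eqxx big1 ?addr0 // => z /andP[_ zx].
      by rewrite -pair_eqE /pair_eq /= (negPf zx).
    by rewrite big1 // => z _; rewrite -pair_eqE /pair_eq /= (negPf yb) andbF.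
  rewrite sumr_const -[LHS]mulr_natl -(card_no_cancel (linv y)); congr (_%:R * _).
  rewrite -[RHS](fintype.card_image (inv_inj linvK)); apply: eq_card => z.
  rewrite unfold_in; apply/idP/fintype.imageP => [zy|[x + ->]]; last by rewrite inE -no_cancel_linv linvK.
  by exists (linv z); rewrite ?linvK // inE no_cancel_linv.
rewrite big_split /= -mulr_suml -mulr_sumr [\sum_i S i]IHn.
rewrite (bigD1 ab.2) //= eqxx big1 => [|y /negPf -> //]; rewrite addr0 mul1r.
case: n {IHn S} => [|n]; first by rewrite mul0r mulr0 addr0 mul1r.
by rewrite /= -[n.+2%:R]natr1 exprS; move: (q ^+ n) (n.+1%:R) => Q N; ring.
Qed.

Lemma sum_adjacent_weight (m : letter k * letter k -> nat) n :
  (forall ab, (0 < m ab)%N -> no_cancel ab.1 ab.2) ->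
  \sum_(t : n.+1.-tuple (letter k) | reduced t) (adjacent_weight m t)%:R =
  (\sum_ab m ab)%:R * (n%:R * q ^+ n.-1) :> R.
Proof.
move=> m0.
rewrite (sum_tuple_cons n (fun t => reduced t) (fun t => (adjacent_weight m t)%:R)).
transitivity (\sum_(z : letter k) \sum_ab (m ab)%:R *
    \sum_(t : n.-tuple (letter k) | path no_cancel z t) (occurrences ab (z :: t))%:R : R).
  apply: eq_bigr => z _; under [RHS]eq_bigr do rewrite mulr_sumr.
  rewrite exchange_big /=; apply: eq_bigr => t _; rewrite adjacent_weight_count natr_sum.
  by apply: eq_bigr => ab _; rewrite natrM.
rewrite exchange_big natr_sum mulr_suml /=; apply: eq_bigr => ab _; rewrite -mulr_sumr.
have [->|] := posnP (m ab); first by rewrite !mul0r.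
by move=> /m0/sum_occurrences ->.
Qed.

Lemma sum_reduced n : \sum_(t : n.+1.-tuple (letter k) | reduced t) 1 = 2 * k%:R * q ^+ n :> R.
Proof.
rewrite (sum_tuple_cons n (fun t => reduced t) (fun=> 1)).
rewrite (eq_bigr (fun=> q ^+ n)) => [|z _]; last exact: sum_paths.
by rewrite sumr_const card_letter -[LHS]mulr_natl natrM.
Qed.

End AverageWeight.

Section BoundaryMeasure.
Context {k : nat} {R : realType} {hk : (2 <= k)%N}.
Variable mu : probability (borel_boundary hk) R.
Hypothesis hmu : uniform_boundary_measure mu.
Local Notation q := (2 * k%:R - 1 : R).
Implicit Types F : seq (letter k) -> R.

Lemma mkseq_reduced (omega : boundary hk) n : reduced (mkseq omega n).
Proof.
apply/(sortedP (omega 0%N)) => i; rewrite size_mkseq => ni.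
by rewrite !nth_mkseq ?ray_reduced // ltnW.
Qed.

Lemma cylinder_measurable (s : seq (letter k)) :
  measurable (cylinder s : set (borel_boundary hk)).
Proof.
apply: sub_sigma_algebra => omega <-; exists (size s) => omega' /=.
by rewrite /cylinder /= !size_mkseq.
Qed.

(** Functions of the first [n] letters are simple functions on cylinders, which reduces
    measurability and integration to finite sums. *)
Lemma cylinder_decomposition F n (omega : boundary hk) : F (mkseq omega n) =
  \sum_(t : n.-tuple (letter k) | reduced t) F t * \1_(cylinder t : set (borel_boundary hk)) omega.
Proof.
have st : size (mkseq omega n) == n by rewrite size_mkseq.
rewrite (bigD1 (Tuple st)) /= ?mkseq_reduced // big1 => [|t /andP[_ tne]].
  rewrite addr0 indicE mem_set ?mulr1 //.
  by rewrite /cylinder /= size_mkseq.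
rewrite indicE memNset ?mulr0 // /cylinder /= size_tuple => tE.
by move/eqP: tne; apply; apply: val_inj; rewrite /= tE.
Qed.

Lemma measurable_mkseq F n :
  measurable_fun setT (fun omega : borel_boundary hk => F (mkseq (omega : boundary hk) n)).
Proof.
rewrite (_ : (fun _ => _) = (fun omega : borel_boundary hk => \sum_(t : n.-tuple (letter k))
    (if reduced t then F t else 0) * \1_(cylinder t : set (borel_boundary hk)) omega)).
  apply: measurable_sum => t; apply: measurable_funM; first exact: measurable_cst.
  by apply: measurable_indic; exact: cylinder_measurable.
apply/funext => omega; rewrite cylinder_decomposition big_mkcond.
by apply: eq_bigr => t _; case: ifP => // _; rewrite mul0r.
Qed.

Lemma mu_cylinder (s : seq (letter k)) n : reduced s -> size s = n.+1 ->
  mu (cylinder s : set (borel_boundary hk)) = ((2 * k%:R * q ^+ n)^-1)%:E.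
Proof.
move=> rs sn; have := hmu (v := of_word s); rewrite /len word_of_word // sn subn1; apply.
by apply: contra_eq_neq sn => /(congr1 (@word k)); rewrite word_of_word // => ->.
Qed.

Lemma integral_mkseq F n : (forall s, 0 <= F s) ->
  (\int[mu]_omega (F (mkseq (omega : boundary hk) n.+1))%:E =
  ((\sum_(t : n.+1.-tuple (letter k) | reduced t) F t) / (2 * k%:R * q ^+ n))%:E)%E.
Proof.
move=> F0.
pose f (t : n.+1.-tuple (letter k)) (omega : borel_boundary hk) : \bar R :=
  ((if reduced t then F t else 0) * \1_(cylinder t : set (borel_boundary hk)) omega)%:E.
rewrite (eq_integral (fun omega => \sum_(t : n.+1.-tuple (letter k)) f t omega)%E); last first.
  move=> omega _; rewrite cylinder_decomposition sumEFin big_mkcond; congr EFin.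
  by apply: eq_bigr => t _; case: ifP => // _; rewrite mul0r.
rewrite ge0_integral_sum //; first last.
- by move=> t omega _; rewrite lee_fin mulr_ge0 //; case: ifP.
- move=> t; apply/measurable_EFinP; apply: measurable_funM; first exact: measurable_cst.
  by apply: measurable_indic; exact: cylinder_measurable.
rewrite mulr_suml -sumEFin [RHS]big_mkcond; apply: eq_bigr => t _.
rewrite /f; case: ifP => rt; last first.
  by rewrite integral0_eq // => omega _; rewrite mul0r.
under eq_integral do rewrite EFinM.
rewrite ge0_integralZl_EFin //; last first.
  by apply/measurable_EFinP; apply: measurable_indic; exact: cylinder_measurable.
rewrite integral_indic //; last exact: cylinder_measurable.
rewrite setIT [RHS]EFinM; congr (_ * _)%E.
by apply: mu_cylinder; rewrite ?size_tuple.
Qed.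

(** The quotients are bounded by the Lipschitz constant, so by dominated convergence their averages
    tend to [l]; these averages are bounded below by the exact average weight of a reduced word. *)
Lemma stretching_factor_ge phi (l : R) m E :
  (forall ab : letter k * letter k, (0 < m ab)%N -> no_cancel ab.1 ab.2) ->
  (forall s, reduced s -> (adjacent_weight m s <= len (phi (of_word s) : free_group k) + E)%N) ->
  (exists L, forall g : free_group k, (len (phi g) <= L * len g)%N) ->
  is_stretching_factor mu phi l ->
  (\sum_ab m ab)%:R / (2 * k%:R * q) <= l.
Proof.
move=> m0 mE [L HL] Hl.
pose F n (s : seq (letter k)) : R := (len (phi (of_word s)))%:R / n.+1%:R.
have F0 n s : 0 <= F n s by rewrite divr_ge0.
pose f n (omega : borel_boundary hk) : \bar R := (F n (mkseq (omega : boundary hk) n.+1))%:E.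
have mf n : measurable_fun setT (f n) by apply/measurable_EFinP; exact: measurable_mkseq.
have fl : {ae mu, forall omega, [set: borel_boundary hk] omega -> f ^~ omega @ \oo --> l%:E}.
  apply: (@filterS _ _ (ae_filter_ringOfSetsType mu)) Hl => omega H _; apply: cvg_EFin; first by apply: nearW.
  by move: H; rewrite -cvg_shiftS.
have fL : {ae mu, forall omega n, [set: borel_boundary hk] omega -> (`|f n omega| <= L%:R%:E)%E}.
  apply: aeW => omega n _; rewrite /f abse_EFin lee_fin ger0_norm // ler_pdivrMr //.
  rewrite -natrM ler_nat (leq_trans (HL _)) // leq_mul2l.
  by rewrite /len word_of_word ?mkseq_reduced // size_mkseq leqnn orbT.
have [_ _] := @dominated_convergence _ _ _ mu setT measurableT f (cst l%:E) (cst L%:R%:E)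
  mf (measurable_cst _) fl (finite_measure_integrable_cst _ _ measurableT) fL.
rewrite integral_cst // [X in (_ * X)%E](_ : _ = 1%E); last exact: probability_setT.
rewrite mule1 => H.
have K2 := k2R (R := R) hk; have q0 : 0 < q by lra.
(* A word of length [n.+1] has [n] adjacent pairs, so the lower bound is [(c * n - E) / n.+1], which
   is [u n]. *)
set c := _ / _; pose u n : R := c - (c + E%:R) * harmonic n.
have uc : u n @[n --> \oo] --> c.
  rewrite -[X in _ --> X]subr0 -(mulr0 (c + E%:R)); apply: cvgB; first exact: cvg_cst.
  by apply: cvgMl_tmp; exact: cvg_harmonic.
rewrite -lee_fin; apply: (lee_cvg_to (f := fun n => (u n)%:E)) H _.
  by apply: cvg_EFin uc; exact: nearW.
apply: nearW => n /=; rewrite integral_mkseq // lee_fin /u /F.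
have H1 : (\sum_ab m ab)%:R * (n%:R * q ^+ n.-1) - E%:R * (2 * k%:R * q ^+ n) <=
    \sum_(t : n.+1.-tuple (letter k) | reduced t) (len (phi (of_word t)))%:R.
  rewrite -(sum_adjacent_weight n m0) -(sum_reduced n) mulr_sumr -sumrB.
  by apply: ler_sum => t rt; rewrite mulr1 lerBlDr -natrD ler_nat mE.
rewrite -mulr_suml ler_pdivlMr ?mulr_gt0 ?exprn_gt0 //; last by lra.
rewrite ler_pdivlMr // (le_trans _ H1) // /harmonic /=.
rewrite le_eqVlt; apply/orP; left; apply/eqP; rewrite /c.
case: n {H1} => [|n]; first by rewrite !expr0 /=; field; rewrite ?gt_eqF //; lra.
rewrite exprS /= -[n.+2%:R]natr1; move: (q ^+ n) => Q; field.
rewrite !gt_eqF //; try lra.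
Qed.

End BoundaryMeasure.

(** * The equivalences *)

Section MainTheorem.
Context {k : nat} {R : realType} {hk : (2 <= k)%N}.
Local Notation q := (2 * k%:R - 1 : R).
Implicit Types phi : {multiplicative free_group k -> free_group k}.

Lemma nonsimple_weight_real phi : bijective phi -> ~ simple_aut phi ->
  exists (m : letter k * letter k -> nat) E,
  [/\ forall ab, (0 < m ab)%N -> no_cancel ab.1 ab.2,
      forall s, reduced s -> (adjacent_weight m s <= len (phi (of_word s)) + E)%N &
      2 * k%:R * q + 2 * (2 * k%:R - 3) <= (\sum_ab m ab)%:R].
Proof.
move=> bphi nsimple; have [m [E [m0 mE mT]]] := nonsimple_weight hk bphi nsimple.
exists m, E; split => //; move: mT; rewrite -(ler_nat R).
by rewrite natrD !natrM !natrB ?natrM //; lia.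
Qed.

Lemma exp_CR_generic_nonempty (C : set (free_group k)) : exp_CR_generic R C -> exists w, C w.
Proof.
move=> [_ [D [s [D0 /andP[s0 s1] HC]]]]; apply: contrapT => /forallNP C0.
have prob0 n : CR_prob R n C = 0.
  rewrite /CR_prob (_ : #|_| = 0%N) ?mul0r //; apply: eq_card0 => t.
  by rewrite !inE; apply/negP => /andP[_ /asboolP/C0].
have s1' : `|s| < 1 by rewrite ger0_norm // ltW.
have : 1 <= (0 : R); last by rewrite ler10.
apply: (cvgr_to_ge (cvg_geometric D s1')); exists 1%N => // n n1.
by have := HC n n1; rewrite prob0 sub0r normrN1.
Qed.

(** If [phi] is not simple, every pair of positive weight occurs at least [theta * len w] times, and
    [weight_cyclic_len] makes [phi w] cyclically longer than [d0] allows. *)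
Lemma simple_aut_of_frequent (theta d0 : R) phi w : 0 < theta ->
  d0 < (2 * k%:R * q + 2 * (2 * k%:R - 3)) * theta ->
  bijective phi -> frequent theta w ->
  (cyclic_len (phi w))%:R <= d0 * (cyclic_len w)%:R -> simple_aut phi.
Proof.
move=> theta0 d0theta bphi [cw w1 Hw] le_d0; apply: contrapT => nsimple.
have [m [E [m0 mE mT]]] := nonsimple_weight_real bphi nsimple.
have len0 : 0 < (len w)%:R :> R.
  rewrite ltr0n lt0n; apply: contraNneq w1 => l0; apply/eqP/word_inj.
  exact: size0nil l0.
have := weight_cyclic_len cw mE; rewrite -(ler_nat R) => /le_trans /(_ le_d0).
rewrite cyclic_len_id // leNgt => /negP; apply.
apply: lt_le_trans (_ : (\sum_ab m ab)%:R * (theta * (len w)%:R) <= _).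
  rewrite mulrA ltr_pM2r //; apply: lt_le_trans d0theta _.
  by rewrite ler_pM2r.
rewrite adjacent_weight_count !natr_sum mulr_suml; apply: ler_sum => ab _; rewrite natrM.
by have [->|/m0/Hw] := posnP (m ab); [rewrite !mul0r | exact: ler_wpM2l].
Qed.

Variable mu : probability (borel_boundary hk) R.
Hypothesis hmu : uniform_boundary_measure mu.

Lemma simple_aut_of_stretching_factor phi (l : R) : bijective phi ->
  is_stretching_factor mu phi l ->
  l < 1 + (2 * k%:R - 3) / (2 * k%:R ^+ 2 - k%:R) -> simple_aut phi.
Proof.
move=> bphi Hl lt_l; apply: contrapT => nsimple.
have [m [E [m0 mE mT]]] := nonsimple_weight_real bphi nsimple.
have := stretching_factor_ge hmu m0 mE (morph_lipschitz (@gmulfM _ _ phi)) Hl.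
apply/negP; rewrite -ltNge (lt_le_trans lt_l) //.
have K2 := k2R (R := R) hk; rewrite ler_pdivlMr; last by nra.
(* The threshold is exactly the minimal total weight divided by the number [2k (2k - 1)] of reduced
   two-letter words. *)
apply: le_trans mT; rewrite le_eqVlt; apply/orP; left; apply/eqP; field.
by apply: lt0r_neq0; nra.
Qed.

(** Here the limit exists along every ray, since a simple automorphism changes lengths by a bounded
    amount. *)
Lemma simple_aut_stretching_factor phi : simple_aut phi -> is_stretching_factor mu phi 1.
Proof.
move=> /simple_aut_len[D HD]; apply: aeW => omega.
rewrite -cvg_shiftS /=.
apply: (@squeeze_cvgr _ _ _ _ (fun n => 1 - D%:R * harmonic n) (fun n => 1 + D%:R * harmonic n)).
- apply: nearW => n; rewrite /harmonic /=.
  have [] := HD (initial_segment omega n.+1).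
  have -> : len (initial_segment omega n.+1) = n.+1.
    by rewrite /len word_of_word ?mkseq_reduced // size_mkseq.
  rewrite -!(ler_nat R) !natrD => H1 H2.
  rewrite ler_pdivlMr // ler_pdivrMr // !mulrDl mulNr !mul1r !mulfVK ?pnatr_eq0 //.
  by apply/andP; split; lra.
- rewrite -[X in _ --> X]subr0 -(mulr0 D%:R); apply: cvgB; first exact: cvg_cst.
  by apply: cvgMl_tmp; exact: cvg_harmonic.
- rewrite -[X in _ --> X]addr0 -(mulr0 D%:R); apply: cvgD; first exact: cvg_cst.
  by apply: cvgMl_tmp; exact: cvg_harmonic.
Qed.

Lemma simple_aut_rough_isometry phi : simple_aut phi ->
  rough_isometry (@word_dist k R) (@word_dist k R) phi.
Proof.
move=> /simple_aut_len[D HD]; exists (D%:R + 1); split=> [|u v].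
  by rewrite ltr_wpDl.
have phiM := @gmulfM _ _ phi.
rewrite /word_dist -(morph_V phiM) -phiM.
by have [] := HD (u^-1 * v)%g; rewrite -!(ler_nat R) !natrD ler_norml; lra.
Qed.

End MainTheorem.

Theorem theorem6 (R : realType) (k : nat) (hk : (2 <= k)%N)
    (mu : probability (borel_boundary hk) R)
    (hmu : uniform_boundary_measure mu) :
  let d0 : R := 1 + (2 * k%:R - 3) / (4 * k%:R ^+ 2 - 2 * k%:R) in
  exists C : set (free_group k),
    exp_CR_generic R C /\
    forall phi : {multiplicative free_group k -> free_group k},
      bijective phi ->
      [<-> simple_aut phi;
           is_stretching_factor mu phi 1;
           exists2 l : R, is_stretching_factor mu phi l
             & l < 1 + (2 * k%:R - 3) / (2 * k%:R ^+ 2 - k%:R);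
           rough_isometry (@word_dist k R) (@word_dist k R) phi;
           rough_similarity (@word_dist k R) (@word_dist k R) phi;
           exists2 w, C w & cyclic_len (phi w) = cyclic_len w;
           forall w, C w -> cyclic_len (phi w) = cyclic_len w;
           exists2 w, C w
             & (cyclic_len (phi w))%:R <= d0 * (cyclic_len w)%:R;
           forall w, C w ->
             (cyclic_len (phi w))%:R <= d0 * (cyclic_len w)%:R].
Proof.
move=> d0.
have K2 := k2R (R := R) hk.
pose q : R := 2 * k%:R - 1; pose T : R := 2 * k%:R * q + 2 * (2 * k%:R - 3).
have kq0 : 0 < 2 * k%:R * q by rewrite /q; nra.
have T0 : 0 < T by rewrite /T; lra.
(* [d0] is the midpoint between 1 and the generic stretching bound [T / (2k q)]. *)
have d0E : d0 * (2 * k%:R * q) = 2 * k%:R * q + (2 * k%:R - 3).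
  by rewrite /d0 /q; field; apply: lt0r_neq0; nra.
have d01 : 1 <= d0 by rewrite -(ler_pM2r kq0) d0E; lra.
have d0T : d0 / T < (2 * k%:R * q)^-1.
  by rewrite ltr_pdivrMr // mulrC ltr_pdivlMr // d0E /T; lra.
(* Any value strictly between [d0 / T] and the limiting frequency [1 / (2k q)] serves: the lower
   bound forces stretching beyond [d0], the upper one gives genericity. *)
pose theta := (d0 / T + (2 * k%:R * q)^-1) / 2.
have d0T0 : 0 < d0 / T by rewrite divr_gt0 //; lra.
have thT : d0 < T * theta by rewrite mulrC -ltr_pdivrMr // /theta; lra.
have th0 : 0 < theta by rewrite /theta; lra.
have gen : exp_CR_generic R (frequent theta : set (free_group k)).
  by apply: (frequent_generic hk); rewrite th0 /=; move: d0T; rewrite /theta /q; lra.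
exists (frequent theta); split=> // phi bphi.
have [w0 Cw0] := exp_CR_generic_nonempty gen.
have le_d0 w : cyclic_len (phi w) = cyclic_len w ->
    (cyclic_len (phi w))%:R <= d0 * (cyclic_len w)%:R.
  by move=> ->; rewrite ler_peMl.
have simple w : frequent theta w ->
    (cyclic_len (phi w))%:R <= d0 * (cyclic_len w)%:R -> simple_aut phi.
  exact: simple_aut_of_frequent thT bphi.
tfae.
- exact: simple_aut_stretching_factor.
- move=> H; exists 1 => //; rewrite ltrDl divr_gt0 //; [lra|nra].
- move=> [l Hl lt_l]; apply: simple_aut_rough_isometry.
  exact: simple_aut_of_stretching_factor hmu _ _ bphi Hl lt_l.
- move=> [D [D0 HD]]; exists 1, D; split=> // u v; by rewrite mul1r.
- move=> /(rough_similarity_cyclic_len hk bphi) H; by exists w0.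
(* As [1 <= d0], preserving the cyclic length of one word of the set already makes [phi] simple,
   hence preserves all cyclic lengths. *)
- move=> [w Cw wE] v _; apply: simple_aut_cyclic_len.
  by apply: simple Cw _; exact: le_d0.
- by move=> H; exists w0 => //; exact: le_d0 (H _ Cw0).
- move=> [w Cw /(simple _ Cw) H] v _; exact: le_d0 (simple_aut_cyclic_len v H).
- by move=> H; exact: simple Cw0 (H _ Cw0).
Qed.
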